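(* Let $s\in(0,1)$, let $\Omega\subset\mathbb{R}^n$ be a bounded open set with Lipschitz boundary and let $E\subset\mathbb{R}^n$. The following are equivalent: (i) $E$ is $s$-minimal in $\Omega$; (ii) $P_s(E,\Omega)<\infty$ and $P_s(E,\Omega)\leq P_s(F,\Omega)$ for every $F\subset\mathbb{R}^n$ such that $E\Delta F\subset\subset\Omega$; (iii) $E$ is locally $s$-minimal in $\Omega$.
   Context: All sets are Lebesgue measurable and are identified up to sets of measure zero. For disjoint $A,B\subset\mathbb{R}^n$ put $\mathcal{L}_s(A,B)=\int_A\int_B\frac{dx\,dy}{|x-y|^{n+s}}\in[0,\infty]$. The $s$-perimeter of $E\subset\mathbb{R}^n$ in an open set $\Omega\subset\mathbb{R}^n$ is, writing $E^c=\mathbb{R}^n\setminus E$, $$P_s(E,\Omega)=\mathcal{L}_s(E\cap\Omega,E^c\cap\Omega)+\mathcal{L}_s(E\cap\Omega,E^c\setminus\Omega)+\mathcal{L}_s(E\setminus\Omega,E^c\cap\Omega).$$ $A\subset\subset B$ means that $\overline{A}$ is compact and $\overline{A}\subset B$. For an open set $\Omega$ (not necessarily bounded), $E$ is $s$-minimal in $\Omega$ if $P_s(E,\Omega)<\infty$ and $P_s(E,\Omega)\leq P_s(F,\Omega)$ for every $F\subset\mathbb{R}^n$ with $F\setminus\Omega=E\setminus\Omega$. $E$ is locally $s$-minimal in $\Omega$ if it is $s$-minimal in every open set $\Omega'\subset\subset\Omega$. *)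

(* Defs.v *)
From HB Require Import structures.
From mathcomp Require Import all_boot all_order all_algebra.
From mathcomp Require Import all_classical all_reals all_analysis.

Set Implicit Arguments.
Unset Strict Implicit.
Unset Printing Implicit Defensive.
Import Order.TTheory GRing.Theory Num.Theory.
Import numFieldNormedType.Exports.

Local Open Scope classical_set_scope.
Local Open Scope ring_scope.

(* Borel sigma-algebra on matrices, generated by the entries. *)
Definition measure_matrix_display : measure_display -> measure_display.
Proof. exact. Qed.

Section measurable_matrix.
Context {R : realType} (m n : nat).

Definition matrix_entry_preimages : set (set 'M[R]_(m, n)) :=
  [set B | exists i j, exists2 C : set R,
     measurable C & B = [set M : 'M[R]_(m, n) | C (M i j)]].

HB.instance Definition _ := @isMeasurable.Build
  (measure_matrix_display default_measure_display) 'M[R]_(m, n)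
  <<s matrix_entry_preimages >>
  (@sigma_algebra0 _ _ _) (@sigma_algebraC _ _)
  (@sigma_algebra_bigcup _ _ _).

End measurable_matrix.

Section measurable_entries.
Context {R : realType}.

Lemma measurable_entry m n i j :
  measurable_fun [set: 'M[R]_(m, n)] (fun M : 'M[R]_(m, n) => (M i j : R)).
Proof.
move=> _ C mC; rewrite setTI.
by apply: sub_sigma_algebra; exists i, j, C.
Qed.

Lemma measurable_fun_matrix d (T : measurableType d) m n (f : T -> 'M[R]_(m, n)) :
  (forall i j, measurable_fun [set: T] (fun x => (f x i j : R))) ->
  measurable_fun [set: T] f.
Proof.
move=> mf.
apply: (@measurability _ _ _ _ _ f (@matrix_entry_preimages R m n)) => //.
move=> _ [_ [i [j [C mC ->]]] <-].
by have := mf i j measurableT C mC.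
Qed.

Definition row_cons n (z : R * 'rV[R]_n) : 'rV[R]_n.+1 :=
  row_mx (const_mx z.1 : 'rV[R]_1) z.2.

Definition row_uncons n (v : 'rV[R]_n.+1) : R * 'rV[R]_n :=
  (v 0 0, @rsubmx R 1 1 n v).

Lemma row_consK n : cancel (@row_cons n) (@row_uncons n).
Proof.
move=> [t v]; congr (_, _); last exact: row_mxKr.
have e0 : (0 : 'I_n.+1) = @lshift 1 n 0 by exact/val_inj.
rewrite e0; apply: etrans (row_mxEl _ _ _ _) _.
by rewrite mxE.
Qed.

Lemma measurable_row_cons n : measurable_fun setT (@row_cons n).
Proof.
apply: measurable_fun_matrix => i j.
case: (@split_ordP 1 n j) => k ->.
  rewrite (_ : (fun z => _) = fst); first exact: measurable_fst.
  by apply/funext => z; apply: etrans (row_mxEl _ _ _ _) _; rewrite mxE.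
rewrite (_ : (fun z => _) = (fun v : 'rV[R]_n => v i k) \o snd).
  exact: (measurableT_comp (measurable_entry i k) measurable_snd).
by apply/funext => z; exact: row_mxEr.
Qed.

Lemma measurable_row_uncons n : measurable_fun setT (@row_uncons n).
Proof.
apply: measurable_fun_pair; first exact: measurable_entry.
apply: measurable_fun_matrix => i j.
under eq_fun do rewrite mxE.
exact: measurable_entry.
Qed.

End measurable_entries.

Section lebesgue_rV_step.
Context {R : realType} (n : nat).
Variable mu : {sigma_finite_measure set 'rV[R]_n -> \bar R}.

Definition lebesgue_rV_step : set 'rV[R]_n.+1 -> \bar R :=
  pushforward (@lebesgue_measure R \x mu)%E (@row_cons R n).

Let mcons A : measurable A -> measurable (@row_cons R n @^-1` A).
Proof. by move=> mA; rewrite -[X in measurable X]setTI; exact: measurable_row_cons. Qed.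

Let step0 : lebesgue_rV_step set0 = 0%E.
Proof. by rewrite /lebesgue_rV_step /pushforward preimage_set0 measure0. Qed.

Let step_ge0 A : (0 <= lebesgue_rV_step A)%E.
Proof. by rewrite /lebesgue_rV_step /pushforward measure_ge0. Qed.

Let step_sigma_additive : semi_sigma_additive lebesgue_rV_step.
Proof.
move=> F mF tF mUF; rewrite /lebesgue_rV_step /pushforward preimage_bigcup.
apply: measure_semi_sigma_additive.
- by move=> k; exact: mcons.
- apply/trivIsetP => /= i j _ _ ij; rewrite -preimage_setI.
  by move/trivIsetP : tF => /(_ _ _ _ _ ij) ->//; rewrite preimage_set0.
- by rewrite -preimage_bigcup; exact: mcons.
Qed.

HB.instance Definition _ := isMeasure.Build _ _ _
  lebesgue_rV_step step0 step_ge0 step_sigma_additive.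

Lemma lebesgue_rV_step_sigma_finite : sigma_finite setT lebesgue_rV_step.
Proof.
have /sigma_finiteP[F [FT ndF Foo]] := sigma_finiteT (@lebesgue_measure R).
have /sigma_finiteP[G [GT ndG Goo]] := sigma_finiteT mu.
exists (fun k => @row_uncons R n @^-1` (F k `*` G k)).
  apply/esym; rewrite -subTset => v _.
  have : [set: measurableTypeR R] (v 0 0) by [].
  have : [set: 'rV[R]_n] (@row_uncons R n v).2 by [].
  rewrite FT GT => -[k _ Gk] [l _ Fl]; exists (maxn k l) => //; split.
  - by move: Fl; exact/subsetPset/ndF/leq_maxr.
  - by move: Gk; exact/subsetPset/ndG/leq_maxl.
move=> k; have [mF Fk] := Foo k; have [mG Gk] := Goo k.
split.
  rewrite -[X in measurable X]setTI.
  by apply: measurable_row_uncons => //; exact: measurableX.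
rewrite /lebesgue_rV_step /pushforward -comp_preimage.
rewrite (_ : _ \o _ = id); last by apply/funext => z; exact: row_consK.
by rewrite preimage_id product_measure1E// lte_mul_pinfty// ge0_fin_numE.
Qed.

HB.instance Definition _ := @Measure_isSigmaFinite.Build _ _ _
  lebesgue_rV_step lebesgue_rV_step_sigma_finite.

End lebesgue_rV_step.

Fixpoint borel_lebesgue (R : realType) n :
    {sigma_finite_measure set 'rV[R]_n -> \bar R} :=
  match n with
  | 0 => (\d_(0 : 'rV[R]_0))
  | n'.+1 => lebesgue_rV_step (borel_lebesgue R n')
  end.

Section lebesgue_rV.
Context {R : realType}.

(* n-dimensional Lebesgue measure proper: the completion of [borel_lebesgue],
   defined on the sets that are Caratheodory-measurable for the associated
   outer measure. *)
Definition lebesgue_rV n :=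
  @completed_measure_extension _ _ R (borel_lebesgue R n).
Arguments lebesgue_rV : clear implicits.

HB.instance Definition _ n := Measure.on (lebesgue_rV n).

Lemma lebesgue_rV_sigma_finite n : sigma_finite setT (lebesgue_rV n).
Proof. exact/completed_measure_extension_sigma_finite/sigma_finiteT. Qed.

HB.instance Definition _ n := @Measure_isSigmaFinite.Build _ _ _
  (lebesgue_rV n) (@lebesgue_rV_sigma_finite n).

Definition lebesgue_measurable n (A : set 'rV[R]_n) : Prop :=
  ((borel_lebesgue R n)^*)%mu.-cara.-measurable A.

(* Equality of sets up to a Lebesgue-null set. *)
Definition null_eq n (A B : set 'rV[R]_n) : Prop :=
  (lebesgue_rV n).-negligible (A `+` B).

(* The norm [`|x|] of the library on row vectors is the sup norm. *)
Definition enorm n (x : 'rV[R]_n) : R := Num.sqrt (\sum_i x 0 i ^+ 2).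

End lebesgue_rV.
Arguments lebesgue_rV {R} n _.

Section s_minimal_sets.
Context {R : realType}.

Definition compactly_contained n (A B : set 'rV[R]_n) : Prop :=
  compact (closure A) /\ closure A `<=` B.

(* Near each boundary point, in suitable orthonormal coordinates (t, v) with
   t : R and v : 'rV_n, the set is the strict epigraph g v < t of a Lipschitz
   function g. *)
Definition lipschitz_boundary n (Omega : set 'rV[R]_n.+1) : Prop :=
  forall x, (closure Omega `\` interior Omega) x ->
  exists (Q : 'M[R]_n.+1) (g : 'rV[R]_n -> R),
    [/\ Q *m Q^T = 1%:M, lipschitz g &
        \forall y \near x,
          Omega y <-> g (row_uncons (y *m Q)).2 < (row_uncons (y *m Q)).1].

Definition interaction n (s : R) (A B : set 'rV[R]_n) : \bar R :=
  (\int[lebesgue_rV n]_(x in A) \int[lebesgue_rV n]_(y in B)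
    ((enorm ((x : 'rV[R]_n) - (y : 'rV[R]_n)) `^ (n%:R + s))^-1)%:E)%E.

Definition s_perimeter n (s : R) (E Omega : set 'rV[R]_n) : \bar R :=
  (interaction s (E `&` Omega) (~` E `&` Omega)
   + interaction s (E `&` Omega) (~` E `\` Omega)
   + interaction s (E `\` Omega) (~` E `&` Omega))%E.

Definition s_minimal n (s : R) (Omega E : set 'rV[R]_n) : Prop :=
  (s_perimeter s E Omega < +oo)%E /\
  forall F, lebesgue_measurable F -> null_eq (F `\` Omega) (E `\` Omega) ->
    (s_perimeter s E Omega <= s_perimeter s F Omega)%E.

(* [E `+` F] is the symmetric difference; since sets are identified up to null
   sets, some representative of it has to be compactly contained in Omega. *)
Definition s_minimal_compact n (s : R) (Omega E : set 'rV[R]_n) : Prop :=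
  (s_perimeter s E Omega < +oo)%E /\
  forall F, lebesgue_measurable F ->
    (exists2 D, null_eq (E `+` F) D & compactly_contained D Omega) ->
    (s_perimeter s E Omega <= s_perimeter s F Omega)%E.

Definition locally_s_minimal n (s : R) (Omega E : set 'rV[R]_n) : Prop :=
  forall Omega', open Omega' -> compactly_contained Omega' Omega ->
    s_minimal s Omega' E.

End s_minimal_sets.

(* Main.v *)
Require Import Defs.
From mathcomp Require Import all_boot all_order all_algebra.
From mathcomp Require Import finmap.
From mathcomp Require Import all_classical all_reals all_analysis.
From mathcomp Require Import measurable_realfun ring lra.
Import Order.TTheory GRing.Theory Num.Theory.
Import numFieldNormedType.Exports.
Local Open Scope classical_set_scope.
Local Open Scope ring_scope.
Set Implicit Arguments.
Unset Strict Implicit.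
Unset Printing Implicit Defensive.

(* Writing [nu] for the measure with density the kernel |x - y|^-(N+s) on pairs of points (N = n.+1 is the
   dimension), P_s(E, W) is the [nu]-mass of the pairs of [E `*` ~` E] having a point in [W]. Hence minimality in W
   passes to every measurable A contained in W, as pairs not meeting A contribute equally to E and to a competitor
   equal to E off A; this gives (ii) -> (iii).

   For (iii) -> (i), let d be the distance to the complement of Omega, A_t = {d >= t} and S_t = Omega \ A_t. By the
   previous remark E is minimal in each A_t, t > 0. Comparing E with F inside A_t and E outside gives
   P_s(E, A_t) <= P_s(F, Omega) + 2 L(S_t, A_t), so it suffices to find arbitrarily small t with L(S_t, A_t) small;
   then let A_t increase to Omega. Covering the Lipschitz boundary by small cubes gives |{0 < d < e}| <= M e, and the
   rising sun lemma yields arbitrarily small t with |{t - e <= d < t}| <= (M + 1) e for all e <= t; integrating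
   (t - d)^-s over S_t bounds L(S_t, A_t) by C t^(1-s). Finally P_s(E, Omega) <= P_s(E \ Omega, Omega)
   <= L(Omega, Omega^c) <= C int_Omega d^-s < oo. *)

(** * A rising sun lemma for monotone functions of a real variable *)

Section real_analysis.
Context {R : realType}.

(* The infimum [t] of the [r] with [M * (a - r) <= V a - V r] works: the inequality passes to the infimum by
   monotonicity, and a point below [t] violating the claim would satisfy it too. *)
Lemma rising_sun (V : R -> R) (a M : R) : 0 < a -> 0 <= M ->
  {homo V : x y / x <= y} -> V a - V 0 < M * a ->
  exists t, 0 < t <= a /\ forall r, 0 <= r < t -> V t - V r <= M * (t - r).
Proof.
move=> a0 M0 ndV Va.
pose I := [set r | 0 <= r <= a /\ M * (a - r) <= V a - V r].
have Ia : I a by split; rewrite ?lexx ?(ltW a0)// !subrr mulr0.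
have hlbI : has_lbound I by exists 0 => r [/andP[]].
have hI : has_inf I by split => //; exists a.
set t := inf I.
have t0 : 0 <= t by apply: lb_le_inf; [exists a|move=> r [/andP[]]].
have ta : t <= a by apply: ge_inf.
have It : I t.
  split; first by rewrite t0.
  apply/ler_addgt0Pr => e e0.
  (* The divisor is [M + 1] rather than [M], which may vanish. *)
  have [r Ir rt] := inf_adherent (divr_gt0 e0 (ltr_pwDr ltr01 M0)) hI.
  have tr : t <= r by apply: ge_inf.
  case: Ir => _ Ir; have := ndV _ _ tr.
  have : M * (r - t) <= e.
    apply: (@le_trans _ _ ((M + 1) * (e / (M + 1)))).
      by apply: ler_pM; rewrite ?subr_ge0 ?lerDl// lerBlDl ltW.
    by rewrite mulrC divfK// gt_eqF// ltr_wpDl.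
  rewrite -/t in rt *; nra.
have tgt0 : 0 < t.
  rewrite lt_neqAle t0 andbT; apply/eqP => t00.
  by case: It => _; rewrite -t00 subr0 leNgt Va.
exists t; split; first by rewrite tgt0.
move=> r /andP[r0 rt]; rewrite leNgt; apply/negP => Vr.
suff Ir : I r by have := ge_inf hlbI Ir; rewrite -/t leNgt rt.
case: It => _ It; split; first by rewrite r0 (le_trans (ltW rt)).
lra.
Qed.

End real_analysis.

(** * Integrals controlled by geometric series over dyadic shells *)

Section dyadic_estimates.
Context {d : measure_display} {T : measurableType d} {R : realType}.
Variable mu : {measure set T -> \bar R}.

(** [f] is dominated by the series of the multiples [c k] of the indicators of the [D_ k], which is
    integrated term by term; overlaps of the [D_ k] only enlarge the bound. *)
Lemma integral_le_geometric (D : set T) (f : T -> R) (D_ : (set T)^nat)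
    (c : R^nat) (a q : R) :
  measurable D -> measurable_fun D f -> (forall x, D x -> 0 <= f x) ->
  (forall k, measurable (D_ k)) -> (forall k, 0 <= c k) ->
  D `<=` \bigcup_k D_ k -> (forall k x, D x -> D_ k x -> f x <= c k) ->
  0 <= a -> 0 <= q < 1 ->
  (forall k, ((c k)%:E * mu (D_ k) <= (a * q ^+ k)%:E)%E) ->
  (\int[mu]_(x in D) (f x)%:E <= (a / (1 - q))%:E)%E.
Proof.
move=> mD mf f0 mD_ c0 DD_ fc a0 /andP[q0 q1] cq.
have mg k : measurable_fun D (fun x => (c k * \1_(D_ k) x)%:E).
  apply/measurable_EFinP; apply: measurable_funM => //.
have g0 k x : D x -> (0 <= (c k * \1_(D_ k) x)%:E)%E.
  by move=> _; rewrite lee_fin mulr_ge0.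
apply: (@le_trans _ _
    (\int[mu]_(x in D) \sum_(0 <= k <oo) (c k * \1_(D_ k) x)%:E)%E).
  apply: ge0_le_integral => //.
  - exact/measurable_EFinP.
  - by apply: ge0_emeasurable_sum => // k x Dx _; exact: g0.
  move=> x Dx; have [k _ Dkx] := DD_ _ Dx.
  apply: (@le_trans _ _ (c k * \1_(D_ k) x)%:E).
    by rewrite lee_fin indicE mem_set// mulr1 fc.
  rewrite (nneseriesD1 (n := k))//; last by move=> i _; exact: (g0 i x).
  by rewrite leeDl// nneseries_ge0// => i _ _; exact: (g0 i x).
rewrite integral_nneseries//.
have sumE : (\sum_(0 <= k <oo) (a * q ^+ k)%:E = (a / (1 - q))%:E)%E.
  apply/cvg_lim => //.
  under eq_fun do rewrite sumEFin.
  apply: cvg_EFin; first by near=> n.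
  have := @cvg_geometric_series R a q; rewrite ger0_norm// => /(_ q1).
  by rewrite /series/= /geometric/=.
rewrite -sumE; apply: lee_nneseries => k _.
  by move=> _; apply: integral_ge0 => x Dx; exact: g0.
apply: le_trans (cq k).
under eq_integral do rewrite EFinM.
rewrite ge0_integralZl//; last 2 first.
- exact/measurable_EFinP.
- by rewrite lee_fin.
rewrite integral_indic// lee_wpmul2l ?lee_fin//.
by apply: le_measure; rewrite ?inE//; exact: measurableI.
Unshelve. all: by end_near. Qed.

(** On the shell b / 2^(k+1) < u <= b / 2^k the integrand is at most (b / 2^(k+1))^-s and the
    measure at most M b / 2^k. The products decay with ratio 2^s / 2, which is below 1 because
    [s < 1]. *)
Lemma integral_powR_neg_le (D : set T) (u : T -> R) (s b M : R) :
  0 < s < 1 -> 0 < b -> 0 <= M -> measurable D -> measurable_fun D u ->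
  (forall x, D x -> 0 < u x <= b) ->
  (forall e : R, 0 < e <= b -> (mu (D `&` [set x | (u x <= e)%R]) <= (M * e)%:E)%E) ->
  (\int[mu]_(x in D) (u x `^ (- s))%:E
     <= (2 `^ s / (1 - 2 `^ s / 2) * (M * b `^ (1 - s)))%:E)%E.
Proof.
move=> /andP[s0 s1] b0 M0 mD mu_ ub Mu.
have w0 : 0 < 2 `^ s :> R by rewrite powR_gt0.
have w2 : 2 `^ s < 2 :> R.
  have : 1 `^ (1 - s) < 2 `^ (1 - s) :> R.
    by apply: gt0_ltr_powR; rewrite ?nnegrE ?subr_gt0 ?ltr1n.
  rewrite powR1 => lt1; rewrite -[ltRHS]powRr1// -[X in _ < _ `^ X](subrK s).
  by rewrite powRD ?pnatr_eq0 ?implybT// ltr_pMl.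
set w := 2 `^ s in w0 w2 *.
pose h k : R := b / 2 ^+ k.
have h0 k : 0 < h k by rewrite divr_gt0// exprn_gt0.
have hb k : h k <= b by rewrite ler_pdivrMr ?exprn_gt0// ler_peMr ?(ltW b0)// exprn_ege1// ler1n.
have hs k : h k `^ (- s) = b `^ (- s) * w ^+ k.
  rewrite /h powRM ?(ltW b0)// ?invr_ge0 ?exprn_ge0//; congr (_ * _).
  rewrite -[2 ^+ k]powR_mulrn// -powRN -powRrM mulrNN mulrC powRrM.
  by rewrite powR_mulrn// ltW.
have -> : w / (1 - w / 2) * (M * b `^ (1 - s)) =
          (w * M * b `^ (1 - s)) / (1 - w / 2) by ring.
have mle c : measurable (D `&` [set x | u x <= c]).
  rewrite (_ : [set x | _] = u @^-1` `]-oo, c]%classic); first exact: mu_.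
  by apply/seteqP; split => x /=; rewrite in_itv.
apply: (@integral_le_geometric D _
    (fun k => (D `&` [set x | u x <= h k]) `\` (D `&` [set x | u x <= h k.+1]))
    (fun k => h k.+1 `^ (- s))) => //.
- exact: measurableT_comp (measurable_powR _) mu_.
- by move=> x Dx; exact: powR_ge0.
- by move=> k; exact: measurableD.
- by move=> k; exact: powR_ge0.
- move=> x Dx; have /andP[ux0 uxb] := ub _ Dx.
  have ex : exists k, h k.+1 < u x.
    exists (Num.bound (b / u x)); rewrite ltr_pdivrMr ?exprn_gt0//.
    rewrite mulrC -ltr_pdivrMr//.
    apply: lt_le_trans (archi_boundP _) _; first by rewrite divr_ge0// ltW.
    by rewrite -natrX ler_nat (leq_trans (leqnSn _))// ltnW// ltn_expl.
  (* The least such [k] selects the shell; for [k = 0] the upper bound [u x <= h 0] is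
     [u x <= b]. *)
  case: (ex_minnP ex) => k hk kmin; exists k => //; split.
    split=> //=; case: k hk kmin => [|k] _ kmin; first by rewrite /h divr1.
    by rewrite leNgt; apply/negP => /kmin; rewrite ltnn.
  by move=> -[_ /=]; rewrite leNgt hk.
- move=> k x Dx [_ /= hu]; have {}hu : h k.+1 < u x.
    by rewrite ltNge; apply/negP => ?; exact: hu.
  have ux0 := lt_trans (h0 _) hu.
  rewrite !powRN lef_pV2 ?posrE ?powR_gt0//.
  by rewrite ge0_ler_powR ?nnegrE// ltW.
- by rewrite !mulr_ge0 ?powR_ge0// ltW.
- by rewrite divr_ge0// ?(ltW w0)// ltr_pdivrMr// mul1r.
- move=> k; apply: (@le_trans _ _ ((h k.+1 `^ (- s))%:E * (M * h k)%:E)%E).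
    rewrite lee_wpmul2l ?lee_fin ?powR_ge0//.
    apply: le_trans (Mu _ _); last by rewrite h0 hb.
    by apply: le_measure; rewrite ?inE//; exact: measurableD.
  rewrite -EFinM lee_fin hs exprS /h exprMn exprVn.
  rewrite powRD ?(gt_eqF b0) ?implybT// powRr1 ?(ltW b0)//.
  rewrite le_eqVlt; apply/orP; left; apply/eqP.
  by ring.
Qed.

End dyadic_estimates.

(** * Energies of a symmetric kernel *)

Section nonlocal_energy.
Context {d : measure_display} {T : measurableType d} {R : realType}.
Variable lam : {sigma_finite_measure set T -> \bar R}.
Variable K : T * T -> \bar R.
Hypothesis K_ge0 : forall z, (0 <= K z)%E.
Hypothesis mK : measurable_fun [set: T * T] K.
Hypothesis K_sym : forall x y, K (x, y) = K (y, x).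

Implicit Types (A B E F G W : set T) (Z : set (T * T)).

Definition kernel_interaction A B : \bar R :=
  (\int[lam]_(x in A) \int[lam]_(y in B) K (x, y))%E.

(** The three terms mirror those of [s_perimeter], so that the two are convertible for the Riesz
    kernel. *)
Definition kernel_perimeter E W : \bar R :=
  (kernel_interaction (E `&` W) (~` E `&` W) + kernel_interaction (E `&` W) (~` E `\` W)
   + kernel_interaction (E `\` W) (~` E `&` W))%E.

Definition pair_energy Z : \bar R := (\int[lam \x lam]_(z in Z) K z)%E.

Definition touching W : set (T * T) := W `*` setT `|` setT `*` W.

Let mKD Z : measurable_fun Z K.
Proof. exact: measurable_funS mK. Qed.

Lemma pair_energy_ge0 Z : (0 <= pair_energy Z)%E.
Proof. by apply: integral_ge0. Qed.

Lemma pair_energyS Z1 Z2 : measurable Z1 -> measurable Z2 -> Z1 `<=` Z2 ->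
  (pair_energy Z1 <= pair_energy Z2)%E.
Proof. by move=> m1 m2 s12; apply: ge0_subset_integral. Qed.

Lemma pair_energyU Z1 Z2 : measurable Z1 -> measurable Z2 ->
  [disjoint Z1 & Z2] ->
  pair_energy (Z1 `|` Z2) = (pair_energy Z1 + pair_energy Z2)%E.
Proof. by move=> m1 m2 d12; apply: ge0_integral_setU. Qed.

Lemma pair_energyU_le Z1 Z2 : measurable Z1 -> measurable Z2 ->
  (pair_energy (Z1 `|` Z2) <= pair_energy Z1 + pair_energy Z2)%E.
Proof.
move=> m1 m2; have -> : Z1 `|` Z2 = (Z1 `\` Z2) `|` Z2.
  by rewrite setDE setUIl setUCl setIT.
have mD : measurable (Z1 `\` Z2) by exact: measurableD.
rewrite pair_energyU//.
  by rewrite leeD2r// pair_energyS//; exact: subDsetl.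
by apply/disj_setPS => z [[_ ?] ?].
Qed.

(** Tonelli's theorem for the kernel extended by zero outside the product. *)
Lemma interE A B : measurable A -> measurable B ->
  kernel_interaction A B = pair_energy (A `*` B).
Proof.
move=> mA mB; have mAB : measurable (A `*` B) by exact: measurableX.
have mf : measurable_fun setT (K \_ (A `*` B)).
  by apply/(measurable_restrictT _ mAB).
rewrite /pair_energy integral_mkcond fubini_tonelli1; last 2 first.
- exact: mf.
- by move=> z; rewrite patchE; case: ifP.
rewrite /kernel_interaction integral_mkcond. apply: eq_integral => x _.
rewrite /fubini_F patchE; case: ifPn => xA.
  rewrite [LHS]integral_mkcond; apply: eq_integral => y _.
  by rewrite !patchE in_setX xA.
by apply/esym/integral0_eq => y _; rewrite patchE in_setX (negbTE xA).
Qed.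

Lemma measurable_inner_energy B : measurable B ->
  measurable_fun [set: T] (fun x => \int[lam]_(y in B) K (x, y))%E.
Proof.
move=> mB; have mTB : measurable (setT `*` B : set (T * T)) by exact: measurableX.
have mf : measurable_fun setT (K \_ (setT `*` B)).
  by apply/(measurable_restrictT _ mTB).
rewrite (_ : (fun x => _) = fubini_F lam (K \_ (setT `*` B))).
  apply: measurable_fun_fubini_tonelli_F => // z.
  by rewrite patchE; case: ifP.
apply/funext => x; rewrite /fubini_F [LHS]integral_mkcond; apply: eq_integral => y _.
by rewrite !patchE in_setX in_setT.
Qed.

Lemma inter_le A B (f : T -> \bar R) : measurable A -> measurable B ->
  measurable_fun A f -> (forall x, A x -> (\int[lam]_(y in B) K (x, y) <= f x)%E) ->
  (kernel_interaction A B <= \int[lam]_(x in A) f x)%E.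
Proof.
move=> mA mB mf le_f; apply: ge0_le_integral => //.
- by move=> x _; apply: integral_ge0.
- exact/measurable_funTS/measurable_inner_energy.
Qed.

(** Tonelli in the other order of integration, then the symmetry of [K]. *)
Lemma inter_sym A B : measurable A -> measurable B -> kernel_interaction A B = kernel_interaction B A.
Proof.
move=> mA mB; rewrite interE // /kernel_interaction.
have mAB : measurable (A `*` B) by exact: measurableX.
have mf : measurable_fun setT (K \_ (A `*` B)).
  by apply/(measurable_restrictT _ mAB).
rewrite /pair_energy integral_mkcond fubini_tonelli2; last 2 first.
- exact: mf.
- by move=> z; rewrite patchE; case: ifP.
rewrite [RHS]integral_mkcond; apply: eq_integral => y _.
rewrite /fubini_G patchE; case: ifPn => yB.
  rewrite [RHS]integral_mkcond; apply: eq_integral => x _.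
  by rewrite !patchE in_setX yB andbT K_sym.
by apply: integral0_eq => x _; rewrite patchE in_setX (negbTE yB) andbF.
Qed.

Lemma measurable_touching W : measurable W -> measurable (touching W).
Proof. by move=> mW; apply: measurableU; exact: measurableX. Qed.

Lemma touchingS W1 W2 : W1 `<=` W2 -> touching W1 `<=` touching W2.
Proof. by move=> s12 -[x y] [] [/= ? ?]; [left|right]; split => //; exact: s12. Qed.

Lemma measurable_cross E : measurable E -> measurable (E `*` ~` E).
Proof. by move=> mE; apply: measurableX => //; exact: measurableC. Qed.

(** Membership in [W] sorts the pairs of points into four classes; the perimeter omits only the one
    with both points outside [W]. *)
Lemma perE E W : measurable E -> measurable W ->
  kernel_perimeter E W = pair_energy (E `*` ~` E `&` touching W).
Proof.
move=> mE mW; have mEc := measurableC mE.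
have m1 : measurable (E `&` W) by exact: measurableI.
have m2 : measurable (~` E `&` W) by exact: measurableI.
have m3 : measurable (E `\` W) by exact: measurableD.
have m4 : measurable (~` E `\` W) by exact: measurableD.
rewrite /kernel_perimeter !interE// -!pair_energyU //; try exact: measurableX.
- congr pair_energy; apply/seteqP; split => -[x y] /=.
    move=> [[|]|] /= [[? ?] [? ?]]; split => //; rewrite /touching /=; tauto.
  move=> [[/= Ex Ey]]; rewrite /touching /=.
  have [?|?] := pselect (W x); have [?|?] := pselect (W y); tauto.
- by apply: measurableU; exact: measurableX.
- by apply/disj_setPS => -[x y] [[|]/= [[? ?] [? ?]] [[? ?] ?]].
- by apply/disj_setPS => -[x y] /= [[_ [_ ?]] [_ [_ ?]]].
Qed.

Lemma perS E W1 W2 : measurable E -> measurable W1 -> measurable W2 ->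
  W1 `<=` W2 -> (kernel_perimeter E W1 <= kernel_perimeter E W2)%E.
Proof.
move=> mE m1 m2 s12; rewrite !perE//.
have mZ := measurable_cross mE.
apply: pair_energyS; try by apply: measurableI => //; exact: measurable_touching.
by apply: setIS; exact: touchingS.
Qed.

(* The pairs with no point in [A] contribute the same amount to both sides, since [E] and [G] agree off [A]. *)
Lemma per_le_sub E G A W : measurable E -> measurable G -> measurable A ->
  measurable W -> A `<=` W -> G `\` A = E `\` A ->
  (kernel_perimeter E W < +oo)%E ->
  (kernel_perimeter E W <= kernel_perimeter G W)%E ->
  (kernel_perimeter E A <= kernel_perimeter G A)%E.
Proof.
move=> mE mG mA mW AW GE; rewrite !perE//.
have tA := measurable_touching mA; have tW := measurable_touching mW.
have split_energy X : measurable X ->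
    pair_energy (X `*` ~` X `&` touching W) =
    (pair_energy (X `*` ~` X `&` touching A)
     + pair_energy (X `*` ~` X `&` (touching W `\` touching A)))%E.
  move=> mX; have mZ := measurable_cross mX.
  rewrite -pair_energyU.
  - rewrite -setIUr setDE setUIr setUv setIT.
    congr (pair_energy (_ `&` _)); apply/esym/setUidPr.
    exact: touchingS.
  - exact: measurableI.
  - by apply: measurableI => //; exact: measurableD.
  - by apply/disj_setPS => z [[_ ?] [_ [_ ]]].
have rest : E `*` ~` E `&` (touching W `\` touching A) =
            G `*` ~` G `&` (touching W `\` touching A).
  have GEx x : ~ A x -> G x <-> E x.
    move=> Ax; split=> ?.
      by have [] : (E `\` A) x by rewrite -GE.
    by have [] : (G `\` A) x by rewrite GE.
  apply/seteqP; split => -[x y] [/= [Xx Xy] [tWxy ntA]].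
    split=> //; split => /=; first by apply/GEx => // Ax; apply: ntA; left.
    by move=> /GEx Gy; apply/Xy/Gy => Ay; apply: ntA; right.
  split=> //; split => /=; first by apply/GEx => // Ax; apply: ntA; left.
  by move=> Ey; apply/Xy/GEx => // Ay; apply: ntA; right.
(* The common energy can be cancelled only if it is finite, which the finite perimeter of [E] in [W]
   provides. *)
rewrite !split_energy// rest => Efin.
rewrite leeD2rE// ge0_fin_numE ?pair_energy_ge0//.
by apply: le_lt_trans Efin; rewrite leeDr// pair_energy_ge0.
Qed.

(** Take a pair crossing the glued set and touching [A]. If both points lie in [A], or one of them
    lies outside [W], where [E] and [F] agree, the pair crosses [F]. Otherwise it joins [A] to the
    rest of [W], in one of two orders, whence the two interaction terms. *)
Lemma per_truncation_le E F A W : measurable E -> measurable F ->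
  measurable A -> measurable W -> A `<=` W -> E `\` W = F `\` W ->
  (kernel_perimeter ((F `&` A) `|` (E `\` A)) A
    <= kernel_perimeter F W + (kernel_interaction (W `\` A) A + kernel_interaction (W `\` A) A))%E.
Proof.
move=> mE mF mA mW AW EF.
have mS : measurable (W `\` A) by exact: measurableD.
rewrite [X in (_ + (X + _))%E]inter_sym// !interE// !perE//; last first.
  by apply: measurableU; [exact: measurableI|exact: measurableD].
have mSA : measurable ((W `\` A) `*` A) by exact: measurableX.
have mAS : measurable (A `*` (W `\` A)) by exact: measurableX.
have mF' : measurable (F `*` ~` F `&` touching W).
  by apply: measurableI; [exact: measurable_cross|exact: measurable_touching].
apply: (@le_trans _ _ (pair_energy (F `*` ~` F `&` touching W `|`
    (A `*` (W `\` A) `|` (W `\` A) `*` A)))); last first.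
  apply: le_trans (pair_energyU_le _ _) _ => //; first exact: measurableU.
  by rewrite leeD2l// pair_energyU_le.
apply: pair_energyS.
- apply: measurableI; last exact: measurable_touching.
  by apply: measurable_cross; apply: measurableU;
    [exact: measurableI|exact: measurableD].
- by do 2 (apply: measurableU => //).
have EFx x : ~ W x -> E x <-> F x.
  move=> Wx; split=> ?.
    by have [] : (F `\` W) x by rewrite -EF.
  by have [] : (E `\` W) x by rewrite EF.
move=> -[x y]; rewrite /touching /= => -[[Gx Gy] tA].
have := AW x; have := AW y; have := EFx x; have := EFx y.
have [?|?] := pselect (A x); have [?|?] := pselect (A y);
have [?|?] := pselect (W x); have [?|?] := pselect (W y);
have [?|?] := pselect (F x); have [?|?] := pselect (F y); try tauto.
Qed.

(** A pair crossing [E] but not [F] has a point in the null set where they differ, and such pairs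
    are null for the product measure. *)
Lemma per_null_le E F W : measurable E -> measurable F -> measurable W ->
  lam (E `+` F) = 0%E -> (kernel_perimeter E W <= kernel_perimeter F W)%E.
Proof.
move=> mE mF mW EF0; rewrite !perE//.
have mN : measurable (E `+` F).
  by rewrite /setY; apply: measurableU; exact: measurableD.
have mt := measurable_touching mW.
have mZE := measurable_cross mE; have mZF := measurable_cross mF.
have tN0 : pair_energy (touching (E `+` F)) = 0%E.
  apply: null_set_integral; [exact: measurable_touching|exact: mKD|].
  apply/eqP; rewrite -measure_le0 /touching.
  have le : ((lam \x lam) (touching (E `+` F)) <= 
    (lam \x lam) ((E `+` F) `*` setT) + (lam \x lam) (setT `*` (E `+` F)))%E.
    by apply: measureU2; exact: measurableX.
  apply: le_trans le _.
  rewrite /= !product_measure1E// [X in (X * _)%E]EF0 mul0e add0e.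
  by rewrite [X in (_ * X)%E]EF0 mule0.
rewrite -[leRHS]adde0 -tN0.
apply: le_trans (pair_energyU_le _ _); last 2 first.
- exact: measurableI.
- exact: measurable_touching.
apply: pair_energyS; first exact: measurableI.
  by apply: measurableU; [exact: measurableI|exact: measurable_touching].
move=> -[x y]; rewrite /touching /setY /= => -[[Ex Ey] tW].
have [?|?] := pselect (F x); have [?|?] := pselect (F y); tauto.
Qed.

Lemma per_null E F W : measurable E -> measurable F -> measurable W ->
  lam (E `+` F) = 0%E -> kernel_perimeter E W = kernel_perimeter F W.
Proof.
move=> mE mF mW EF0; apply/eqP; rewrite eq_le !per_null_le//.
by rewrite setYC.
Qed.

(** Monotone convergence: the pairs touching the union are the increasing union of those touching
    each [B i]. *)
Lemma per_bigcup_le E (B : (set T)^nat) c : measurable E ->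
  (forall i, measurable (B i)) -> {homo B : n m / (n <= m)%N >-> n `<=` m} ->
  (forall i, (kernel_perimeter E (B i) <= c)%E) -> (kernel_perimeter E (\bigcup_i B i) <= c)%E.
Proof.
move=> mE mB ndB Bc; rewrite perE//; last exact: bigcup_measurable.
have -> : E `*` ~` E `&` touching (\bigcup_i B i) =
    \bigcup_i (E `*` ~` E `&` touching (B i)).
  rewrite -setI_bigcupr; congr (_ `&` _); apply/seteqP; split => -[x y].
    by case=> [[/= [i _ Bi] _]|[/= _ [i _ Bi]]]; exists i => //; [left|right].
  by move=> [i _ []] [/= ? ?]; [left|right]; split => //; exists i.
have cvgB : pair_energy (E `*` ~` E `&` touching (B i)) @[i --> \oo] -->
    pair_energy (\bigcup_i (E `*` ~` E `&` touching (B i))).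
  apply: ge0_nondecreasing_set_cvg_integral => //.
    by move=> i j ij; apply/subsetPset; apply: setIS; exact/touchingS/ndB.
  move=> i; apply: measurableI; first exact: measurable_cross.
  exact: measurable_touching.
rewrite -(cvg_lim _ cvgB)//; apply: lime_le.
  by apply/cvg_ex; eexists; exact: cvgB.
by near=> i; rewrite -perE.
Unshelve. all: by end_near. Qed.

End nonlocal_energy.

(** * Lebesgue measure on row vectors *)

Section row_norm.
Context {R : realType} {n : nat}.
Implicit Types v : 'rV[R]_n.

Lemma entry_le_norm v j : `|v 0 j| <= `|v|.
Proof.
rewrite /Num.norm/= mx_normrE.
exact: (@le_bigmax _ _ _ 0 (fun ij : 'I_1 * 'I_n => `|v ij.1 ij.2|) (0, j)).
Qed.

Lemma norm_le_entry v (c : R) : 0 <= c -> (forall j, `|v 0 j| <= c) -> `|v| <= c.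
Proof.
move=> c0 vc; rewrite /Num.norm/= mx_normrE; apply: bigmax_le => //.
by move=> [i j] _ /=; rewrite (ord1 i).
Qed.

Lemma norm_le_enorm v : `|v| <= enorm v.
Proof.
apply: norm_le_entry; first exact: sqrtr_ge0.
move=> j; rewrite -sqrtr_sqr ler_wsqrtr// (bigD1 j)//= lerDl.
by apply: sumr_ge0 => i _; exact: sqr_ge0.
Qed.

Lemma enormN v : enorm (- v) = enorm v.
Proof. by congr Num.sqrt; apply: eq_bigr => i _; rewrite mxE sqrrN. Qed.

End row_norm.

Section borel_sets.
Context {R : realType} {n : nat}.

(** The cube is described entry by entry, the form that splits off one coordinate in the induction
    on the dimension. *)
Lemma measurable_norm_ball (x : 'rV[R]_n) (r : R) :
  measurable [set y : 'rV[R]_n | forall i, `|x 0 i - y 0 i| < r].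
Proof.
rewrite (_ : mkset _ = \bigcap_(i in [set: 'I_n])
    ((fun y : 'rV[R]_n => y 0 i) @^-1` ball (x 0 i) r)); last first.
  apply/seteqP; split => [y xy i _|y xy i]; first exact: xy.
  exact: (xy i I).
apply: fin_bigcap_measurable => // i _.
rewrite -[X in measurable X]setTI; apply: measurable_entry => //.
exact: measurable_ball.
Qed.

(** The sigma-algebra is generated by the entries, not by the open sets, so [U] is written as a
    countable union of cubes with rational centres and radii 1/(k+1). *)
Lemma open_measurable_rV (U : set 'rV[R]_n) : open U -> measurable U.
Proof.
move=> oU.
pose B (p : 'rV[rat]_n * nat) := [set y : 'rV[R]_n |
  forall i, `|map_mx ratr p.1 0 i - y 0 i| < p.2.+1%:R^-1].
rewrite (_ : U = \bigcup_(p in [set p | B p `<=` U]) B p); last first.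
  apply/seteqP; split; last by move=> y [p pU py]; exact: pU.
  move=> x Ux; have /nbhs_ballP[e /= e0 eU] := open_nbhs_nbhs (conj oU Ux).
  (* With 1/(k+1) < e/2, a cube of this radius containing [x] has diameter below [e], hence stays in
     [ball x e]. *)
  pose k := Num.bound (2 / e).
  have ke : k.+1%:R^-1 < e / 2.
    rewrite -(invf_div 2 e) ltf_pV2 ?posrE ?divr_gt0//.
    apply: lt_trans (archi_boundP _) _; first by rewrite divr_ge0// ltW.
    by rewrite ltr_nat.
  have qx i : exists q : rat, `|ratr q - x 0 i| < k.+1%:R^-1.
    have : x 0 i - k.+1%:R^-1 < x 0 i + k.+1%:R^-1.
      by rewrite ltrBlDr -addrA ltrDl addr_gt0.
    by move=> /rat_in_itvoo[q]; rewrite in_itv/= => ?; exists q; rewrite ltr_distl.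
  have [q qE] := choice qx.
  exists (\row_i q i, k); last by move=> i; rewrite !mxE.
  move=> y By; apply: eU; split => // i j; rewrite (ord1 i) /ball/=.
  rewrite (splitr e) (le_lt_trans (ler_distD (ratr (q j)) _ _))// ltrD//.
    by rewrite distrC (lt_trans (qE j)).
  by apply: lt_trans ke; have := By j; rewrite !mxE.
rewrite bigcup_mkcond; apply: countable_bigcupT_measurable => // p.
by case: ifP => _ //; exact: measurable_norm_ball.
Qed.

End borel_sets.

Section row_split.
Context {R : realType} {n : nat}.

Lemma row_cons0 (z : R * 'rV[R]_n) : row_cons z 0 0 = z.1.
Proof. exact: (congr1 fst (row_consK z)). Qed.

Lemma row_consS (z : R * 'rV[R]_n) j : row_cons z 0 (rshift 1 j) = z.2 0 j.
Proof. by rewrite -[in RHS](row_consK z) [RHS]mxE. Qed.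

Lemma row_unconsS (v : 'rV[R]_n.+1) j : (row_uncons v).2 0 j = v 0 (rshift 1 j).
Proof. by rewrite [LHS]mxE. Qed.

Lemma row_unconsK : cancel (@row_uncons R n) (@row_cons R n).
Proof.
move=> v; apply/rowP => i; case: (@split_ordP 1 n i) => j ->.
  have -> : lshift n j = 0 :> 'I_n.+1 by apply/val_inj; rewrite (ord1 j).
  by rewrite row_cons0.
by rewrite row_consS row_unconsS.
Qed.

Lemma forall_ordS (P : 'I_n.+1 -> Prop) :
  (forall i, P i) <-> P 0 /\ forall j : 'I_n, P (rshift 1 j).
Proof.
split=> [Pi|[P0 PS] i]; first by split.
case: (@split_ordP 1 n i) => j ->; last exact: PS.
by rewrite (_ : lshift n j = 0 :> 'I_n.+1)//; apply/val_inj; rewrite (ord1 j).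
Qed.

End row_split.

(** Induction on the dimension: the measure is pushed forward from a product, and the cube pulls
    back to an interval times a cube of one dimension less. *)
Lemma borel_lebesgue_cube_le {R : realType} n (x : 'rV[R]_n) (r : R) : 0 <= r ->
  (borel_lebesgue R n [set y | forall i, (`|x 0 i - y 0 i| < r)%R]
    <= ((2 * r) ^+ n)%:E)%E.
Proof.
move=> r0; elim: n x => [|n IH] x.
  by rewrite expr0 /= diracE lee_fin lern1 leq_b1.
rewrite /= /lebesgue_rV_step /pushforward.
pose Q := [set y : 'rV[R]_n |
  forall i, (`|(row_uncons x).2 0 i - y 0 i| < r)%R].
rewrite (_ : _ @^-1` _ = ball (x 0 0 : R) r `*` Q); last first.
  apply/seteqP; split => -[t v] /=.
    move=> /forall_ordS; rewrite row_cons0 => -[x0 xS]; split => // j.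
    by have := xS j; rewrite row_consS row_unconsS.
  move=> [x0 xS]; apply/forall_ordS; rewrite row_cons0; split => // j.
  by have := xS j; rewrite row_consS row_unconsS.
rewrite product_measure1E; last 2 first.
- exact: measurable_ball.
- exact: measurable_norm_ball.
rewrite [X in (X * _)%E](lebesgue_measure_ball (x 0 0 : R) r0) exprS EFinM.
rewrite -[r *+ 2]mulr_natl; apply: lee_pmul => //; last exact: (IH (row_uncons x).2).
by rewrite lee_fin mulr_ge0.
Qed.

Section lebesgue_rV_sets.
Context {R : realType} {n : nat}.

Lemma borel_lebesgue_measurable (A : set 'rV[R]_n) :
  measurable A -> lebesgue_measurable A.
Proof. by move=> mA; apply: sub_caratheodory; exact: sub_sigma_algebra. Qed.

Lemma open_lebesgue_measurable (A : set 'rV[R]_n) :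
  open A -> lebesgue_measurable A.
Proof. by move=> /open_measurable_rV; exact: borel_lebesgue_measurable. Qed.

(** The ball lies in the entrywise cube, a Borel set, on which the completion agrees with
    [borel_lebesgue]. *)
Lemma lebesgue_rV_ball_le (x : 'rV[R]_n) (r : R) : 0 <= r ->
  (lebesgue_rV n [set y | (`|x - y| < r)%R] <= ((2 * r) ^+ n)%:E)%E.
Proof.
move=> r0; apply: (le_trans _ (borel_lebesgue_cube_le x r0)).
rewrite -(measurable_mu_extE _ (measurable_norm_ball x r)).
apply: le_mu_ext => y /= xy i; apply: le_lt_trans xy.
by have := entry_le_norm (x - y) i; rewrite !mxE.
Qed.

Lemma norm_ball_lebesgue_measurable (x : 'rV[R]_n) (r : R) :
  lebesgue_measurable [set y | `|x - y| < r].
Proof.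
apply: open_lebesgue_measurable.
by have := @ball_open R 'rV[R]_n x r; rewrite mx_norm_ball.
Qed.

End lebesgue_rV_sets.

(** * The Riesz kernel and its tail integrals *)

Section riesz_kernel.
Context {R : realType} {n : nat} (s : R).

Definition riesz_kernel (z : 'rV[R]_n * 'rV[R]_n) : \bar R :=
  ((enorm (z.1 - z.2) `^ (n%:R + s))^-1)%:E.

Lemma riesz_kernel_ge0 z : (0 <= riesz_kernel z)%E.
Proof. by rewrite lee_fin invr_ge0 powR_ge0. Qed.

Lemma riesz_kernel_sym x y : riesz_kernel (x, y) = riesz_kernel (y, x).
Proof. by rewrite /riesz_kernel/= -enormN opprB. Qed.

Local Notation rVn := (caratheodory_type ((borel_lebesgue R n)^*)%mu).

Lemma measurable_entry_lebesgue (i : 'I_n) :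
  measurable_fun [set: rVn] (fun x : rVn => (x : 'rV[R]_n) 0 i).
Proof.
move=> _ C mC; apply: borel_lebesgue_measurable.
exact: measurable_entry.
Qed.

Lemma measurable_riesz_kernel :
  measurable_fun [set: rVn * rVn] (riesz_kernel : rVn * rVn -> \bar R).
Proof.
apply/measurable_EFinP.
under eq_fun do rewrite -powRN.
apply: measurableT_comp (measurable_powR _) _.
apply: (measurableT_comp (f := @Num.sqrt R)).
  apply: continuous_measurable_fun; exact: sqrt_continuous.
apply: measurable_sum => i.
under eq_fun do rewrite !mxE.
apply: measurable_funX; apply: measurable_funB.
- exact: (measurableT_comp (measurable_entry_lebesgue i) measurable_fst).
- exact: (measurableT_comp (measurable_entry_lebesgue i) measurable_snd).
Qed.

(** On the sup-norm shell 2^k r <= |x - y| < 2^(k+1) r the kernel is at most (2^k r)^-(n+s), as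
    [enorm] dominates the sup norm, and the volume is at most (4 2^k r)^n. The products are 4^n r^-s
    times the powers of 2^-s. *)
Lemma integral_riesz_kernel_le (x : 'rV[R]_n) (B : set 'rV[R]_n) (r : R) :
  0 < s -> 0 < r -> lebesgue_measurable B -> (forall y, B y -> r <= `|x - y|) ->
  (\int[lebesgue_rV n]_(y in B) riesz_kernel (x, y)
     <= (4 ^+ n / (1 - 2 `^ (- s)) * r `^ (- s))%:E)%E.
Proof.
move=> s0 r0 mB Br.
have w0 : 0 < 2 `^ (- s) :> R by rewrite powR_gt0.
have w1 : 2 `^ (- s) < 1 :> R.
  rewrite powRN invf_lt1 ?powR_gt0//.
  have : 1 `^ s < 2 `^ s :> R by apply: gt0_ltr_powR; rewrite ?nnegrE ?ltr1n.
  by rewrite powR1.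
set w := 2 `^ (- s) in w0 w1 *.
pose h k : R := 2 ^+ k * r.
have h0 k : 0 < h k by rewrite mulr_gt0// exprn_gt0.
have hs k : h k `^ (- s) = w ^+ k * r `^ (- s).
  rewrite powRM ?exprn_ge0 ?(ltW r0)//; congr (_ * _).
  by rewrite -powR_mulrn// -powRrM mulrC powRrM powR_mulrn// ltW.
have -> : 4 ^+ n / (1 - w) * r `^ (- s) = 4 ^+ n * r `^ (- s) / (1 - w) by ring.
rewrite /riesz_kernel.
apply: (@integral_le_geometric _ _ _ (lebesgue_rV n) B _
  (fun k => [set y | `|x - y| < h k.+1] `\` [set y | `|x - y| < h k])
  (fun k => h k `^ (- (n%:R + s)))).
- exact: mB.
- apply/measurable_EFinP; apply: measurable_funTS.
  apply: (measurableT_comp measurable_riesz_kernel).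
  by apply: measurable_fun_pair => //; exact: measurable_cst.
- by move=> y _; rewrite invr_ge0 powR_ge0.
- by move=> k; apply: measurableD; exact: norm_ball_lebesgue_measurable.
- by move=> k; exact: powR_ge0.
- move=> y By; have xy := Br _ By.
  have ex : exists k, `|x - y| < h k.+1.
    exists (Num.bound (`|x - y| / r)); rewrite -ltr_pdivrMr//.
    apply: lt_le_trans (archi_boundP _) _; first by rewrite divr_ge0// ltW.
    by rewrite -natrX ler_nat (leq_trans (leqnSn _))// ltnW// ltn_expl.
  case: (ex_minnP ex) => k hk kmin; exists k => //; split => //=.
  case: k hk kmin => [|k] _ kmin; first by rewrite /h mul1r; apply/negP; rewrite -leNgt.
  by move=> /kmin; rewrite ltnn.
- move=> k y By [_ /= /negP]; rewrite -leNgt => hxy.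
  have hxy' := le_trans hxy (norm_le_enorm _).
  have e0 := lt_le_trans (h0 k) hxy'.
  rewrite powRN lef_pV2 ?posrE ?powR_gt0//.
  by rewrite ge0_ler_powR ?nnegrE ?addr_ge0// ltW.
- by rewrite mulr_ge0 ?powR_ge0 ?exprn_ge0.
- by rewrite (ltW w0).
- move=> k; apply: (@le_trans _ _
      ((h k `^ (- (n%:R + s)))%:E * ((2 * h k.+1) ^+ n)%:E)%E).
    rewrite lee_wpmul2l ?lee_fin ?powR_ge0//.
    apply: le_trans (lebesgue_rV_ball_le x (ltW (h0 _))).
    apply: le_measure; rewrite ?inE; last exact: subDsetl.
      by apply: measurableD; exact: norm_ball_lebesgue_measurable.
    exact: norm_ball_lebesgue_measurable.
  rewrite -EFinM lee_fin opprD powRD ?(gt_eqF (h0 _)) ?implybT// hs.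
  rewrite (_ : 2 * h k.+1 = 4 * h k); last by rewrite /h exprS; ring.
  rewrite exprMn [h k `^ (- n%:R)]powRN powR_mulrn ?(ltW (h0 _))//.
  rewrite le_eqVlt; apply/orP; left; apply/eqP; field.
  by rewrite expf_neq0// gt_eqF.
Qed.

End riesz_kernel.

(** * Thinness of the boundary layer of a Lipschitz domain *)

Section distance_to_set.
Context {R : realType} {V : normedModType R}.
Variable C : set V.
Hypothesis C0 : C !=set0.

(** On row vectors this is the sup-norm distance, in line with the balls whose volume is estimated
    and, through [norm_le_enorm], with the bounds on the kernel. *)
Definition setdist (x : V) : R := inf [set `|x - y| | y in C].

Let has_inf_dist x : has_inf [set `|x - y| | y in C].
Proof.
by case: C0 => y Cy; split; [exists `|x - y|, y|exists 0 => _ [z _ <-]].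
Qed.

Lemma setdist_le x y : C y -> setdist x <= `|x - y|.
Proof. by move=> Cy; apply: ge_inf; [exact: (has_inf_dist x).2|exists y]. Qed.

Lemma setdist_lt x e : setdist x < e -> exists2 y, C y & `|x - y| < e.
Proof.
rewrite -subr_gt0 => xe; have [_ [y Cy <-]] := inf_adherent xe (has_inf_dist x).
by rewrite -/(setdist x) subrKC; exists y.
Qed.

Lemma setdist_lipschitz x y : setdist x <= setdist y + `|x - y|.
Proof.
apply/ler_addgt0Pr => e e0.
have [|z Cz yz] := @setdist_lt y (setdist y + e); first by rewrite ltrDl.
apply: (le_trans (setdist_le x Cz)); apply: (le_trans (ler_distD y _ _)).
by rewrite [leRHS]addrAC [leRHS]addrC lerD2l ltW.
Qed.

Lemma open_setdist_lt e : open [set x | setdist x < e].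
Proof.
rewrite (_ : mkset _ = \bigcup_(y in C) ball y e); last first.
  apply/seteqP; split => [x /setdist_lt[y Cy xy]|x [y Cy yx] /=].
    by exists y => //; rewrite -ball_normE /= distrC.
  by apply: le_lt_trans (setdist_le x Cy) _; move: yx; rewrite -ball_normE /= distrC.
by apply: bigcup_open => y _; exact: ball_open.
Qed.

Lemma closed_setdist_ge e : closed [set x | e <= setdist x].
Proof.
rewrite (_ : mkset _ = ~` [set x | setdist x < e]).
  by rewrite closedC; exact: open_setdist_lt.
by apply/seteqP; split => x /=; rewrite leNgt => /negP.
Qed.

Lemma open_setdist_gt e : open [set x | e < setdist x].
Proof.
rewrite openE => x /= ex; apply/nbhs_ballP.
exists (setdist x - e); first by rewrite /= subr_gt0.
move=> y; rewrite -ball_normE /=; have := setdist_lipschitz x y; lra.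
Qed.

Lemma setdist_ge0 x : 0 <= setdist x.
Proof.
by rewrite leNgt; apply/negP => /setdist_lt[y _]; rewrite ltNge normr_ge0.
Qed.

Lemma setdist_eq0 x : C x -> setdist x = 0.
Proof.
move=> Cx; apply/eqP; rewrite eq_le setdist_ge0 andbT.
by have := setdist_le x Cx; rewrite subrr normr0.
Qed.

Lemma setdist_gt0 x : closed C -> ~ C x -> 0 < setdist x.
Proof.
move=> /closed_openC oC Cx.
have /nbhs_ballP[e /= e0 eC] := open_nbhs_nbhs (conj oC Cx).
apply: (lt_le_trans e0); rewrite leNgt; apply/negP => /setdist_lt[y Cy].
move=> xy; have /eC : ball x e y by rewrite -ball_normE.
exact.
Qed.

End distance_to_set.

Lemma measure_bigsetU_le d (T : ringOfSetsType d) (R : realFieldType)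
    (mu : {content set T -> \bar R}) (I : Type) (r : seq I) (F : I -> set T) :
  (forall i, measurable (F i)) ->
  (mu (\big[setU/set0]_(i <- r) F i) <= \sum_(i <- r) mu (F i))%E.
Proof.
move=> mF.
suff [] : measurable (\big[setU/set0]_(i <- r) F i) /\
    (mu (\big[setU/set0]_(i <- r) F i) <= \sum_(i <- r) mu (F i))%E by [].
elim/big_ind2 : _ => [|A x B y [mA Ax] [mB By]|i _].
- by rewrite measure0.
- split; first exact: measurableU.
  by apply: (le_trans (measureU2 _ mA mB)); exact: leeD.
- by split.
Qed.

(** * Sup-norm estimates for matrices, coordinate splitting and grids *)

Section row_geometry.
Context {R : realType}.

(** An operator bound for the sup norm; the added 1 keeps the constant positive even for a zero
    matrix. *)
Lemma mulmx_norm_le m n (A : 'M[R]_(m, n)) :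
  exists2 c : R, 1 <= c & forall z : 'rV[R]_m, `|z *m A| <= c * `|z|.
Proof.
pose c := 1 + \sum_k \sum_j `|A k j|.
have sum0 : 0 <= \sum_k \sum_j `|A k j| by do 2 (apply: sumr_ge0 => ? _).
exists c => [|z]; first by rewrite lerDl.
apply: norm_le_entry => [|j].
  by rewrite mulr_ge0// (le_trans ler01)// lerDl.
rewrite mxE (le_trans (ler_norm_sum _ _ _))//.
apply: (@le_trans _ _ ((\sum_k \sum_j `|A k j|) * `|z|)); last first.
  by rewrite ler_wpM2r// lerDr.
rewrite mulr_suml; apply: ler_sum => k _; rewrite normrM mulrC.
apply: ler_pM => //; last exact: entry_le_norm.
by rewrite (bigD1 j)//= lerDl sumr_ge0.
Qed.

Lemma row_uncons_dist_le n (x y : 'rV[R]_n.+1) :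
  `|(row_uncons x).1 - (row_uncons y).1| <= `|x - y| /\
  `|(row_uncons x).2 - (row_uncons y).2| <= `|x - y|.
Proof.
split; first by have := entry_le_norm (x - y) 0; rewrite !mxE.
apply: norm_le_entry => // j; rewrite [X in `|X|]mxE [X in _ + X]mxE !row_unconsS.
by have := entry_le_norm (x - y) (rshift 1 j); rewrite !mxE.
Qed.

Lemma grid_approximation n (v0 : 'rV[R]_n) (rho : R) (m : nat) :
  0 < rho -> (0 < m)%N ->
  exists p : 'rV['I_m.+1]_n -> 'rV[R]_n, forall v, `|v - v0| <= rho ->
    exists i, `|v - p i| <= 2 * rho / m%:R.
Proof.
move=> rho0 m0; have mR : 0 < m%:R :> R by rewrite ltr0n.
exists (fun i : 'rV['I_m.+1]_n => \row_j (v0 0 j - rho + 2 * rho / m%:R * (i 0 j)%:R)) => v vv0.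
(* [y j] is the coordinate of [v] measured in grid steps, a number between 0 and [m]; its integer
   part indexes the grid point. *)
pose y j := (v 0 j - v0 0 j + rho) * m%:R / (2 * rho).
have vj j : - rho <= v 0 j - v0 0 j <= rho.
  rewrite -ler_norml; apply: le_trans vv0.
  by have := entry_le_norm (v - v0) j; rewrite !mxE.
have y0 j : 0 <= y j.
  rewrite divr_ge0 ?mulr_ge0 ?(ltW mR) ?(ltW rho0)//.
  by have /andP[+ _] := vj j; rewrite -subr_ge0 opprK.
have ym j : y j <= m%:R.
  rewrite ler_pdivrMr ?mulr_gt0// mulrC ler_wpM2l ?(ltW mR)//.
  by have /andP[_] := vj j; lra.
have km j : (Num.truncn (y j) < m.+1)%N.
  rewrite ltnS -(ler_nat R).
  by have /andP[+ _] := truncn_itv (y0 j); move/le_trans; apply.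
exists (\row_j Ordinal (km j)).
apply: norm_le_entry => [|j].
  by rewrite divr_ge0 ?mulr_ge0 ?(ltW mR) ?(ltW rho0).
rewrite !mxE /=; have /andP[k1 k2] := truncn_itv (y0 j).
move: (Num.truncn (y j)) k1 k2 => k k1 k2.
have -> : v 0 j - (v0 0 j - rho + 2 * rho / m%:R * k%:R) =
          2 * rho / m%:R * (y j - k%:R).
  by rewrite /y; field; rewrite !gt_eqF.
rewrite normrM ger0_norm ?divr_ge0 ?mulr_ge0 ?(ltW mR) ?(ltW rho0)//.
rewrite ler_piMr ?divr_ge0 ?mulr_ge0 ?(ltW mR) ?(ltW rho0)//.
rewrite ger0_norm ?subr_ge0// lerBlDl.
by move: k2; rewrite -natr1 => /ltW.
Qed.

End row_geometry.

Section boundary_layer.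
Context {R : realType} {n : nat}.
Local Notation V := 'rV[R]_n.+1.
Local Notation lam := (lebesgue_rV n.+1).
Implicit Types (Omega S : set V).

(** The intersection with [Omega] matters because the distance vanishes on the complement. *)
Definition boundary_layer Omega (e : R) : set V :=
  Omega `&` [set x | setdist (~` Omega) x < e].

(** A linear volume bound localized to [S]; it is stable under finite unions, hence fit for a
    compactness argument. *)
Definition thin_layer Omega S : Prop :=
  lebesgue_measurable S /\ exists2 M : R, 0 <= M &
    forall e, 0 < e -> (lam (S `&` boundary_layer Omega e) <= (M * e)%:E)%E.

Variable Omega : set V.
Hypothesis oOmega : open Omega.
Hypothesis Omega_proper : ~` Omega !=set0.

Lemma measurable_boundary_layer e : lebesgue_measurable (boundary_layer Omega e).
Proof.
apply: open_lebesgue_measurable; apply: openI => //.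
exact: open_setdist_lt.
Qed.

Lemma lebesgue_le S1 S2 : lebesgue_measurable S1 -> lebesgue_measurable S2 ->
  S1 `<=` S2 -> (lam S1 <= lam S2)%E.
Proof. by move=> m1 m2 s12; apply: le_measure; rewrite ?inE. Qed.

Lemma thin_layer0 : thin_layer Omega set0.
Proof.
split; first by apply: open_lebesgue_measurable; exact: open0.
by exists 0 => // e e0; rewrite set0I measure0 mul0r.
Qed.

Lemma thin_layerU S1 S2 : thin_layer Omega S1 -> thin_layer Omega S2 ->
  thin_layer Omega (S1 `|` S2).
Proof.
move=> [m1 [M1 M10 h1]] [m2 [M2 M20 h2]]; split; first exact: measurableU.
exists (M1 + M2) => [|e e0]; first exact: addr_ge0.
rewrite setIUl mulrDl EFinD; apply: (le_trans (measureU2 _ _ _)).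
- by apply: measurableI => //; exact: measurable_boundary_layer.
- by apply: measurableI => //; exact: measurable_boundary_layer.
- by apply: leeD; [exact: h1|exact: h2].
Qed.

(** Reduction to small scales: once [e >= r], the whole ball has volume at most ((2r)^(n+1) / r)
    e. *)
Lemma thin_layer_ball x r M : 0 < r -> 0 <= M ->
  (forall e, 0 < e < r ->
    (lam (ball x r `&` boundary_layer Omega e) <= (M * e)%:E)%E) ->
  thin_layer Omega (ball x r).
Proof.
move=> r0 M0 hM.
have mb : lebesgue_measurable (ball x r) by apply: open_lebesgue_measurable; exact: ball_open.
split=> //; exists (M + (2 * r) ^+ n.+1 / r) => [|e e0].
  by rewrite addr_ge0// divr_ge0 ?exprn_ge0 ?mulr_ge0 ?(ltW r0).
have c0 : 0 <= (2 * r) ^+ n.+1 / r by rewrite divr_ge0 ?exprn_ge0 ?mulr_ge0 ?(ltW r0).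
have [er|re] := ltP e r.
  apply: le_trans (hM e _) _; first by rewrite e0.
  by rewrite lee_fin ler_wpM2r ?(ltW e0)// lerDl.
apply: (@le_trans _ _ (lam (ball x r))).
  apply: lebesgue_le => //.
  by apply: measurableI => //; exact: measurable_boundary_layer.
have := lebesgue_rV_ball_le x (ltW r0); rewrite mx_norm_ball => /le_trans; apply.
rewrite lee_fin [leRHS]mulrDl -[leLHS]add0r lerD ?mulr_ge0 ?(ltW e0)//.
by rewrite mulrAC ler_pdivlMr// ler_wpM2l// exprn_ge0// mulr_ge0// ltW.
Qed.

(** When the ball of radius [r] is contained in [Omega], the ball of half the radius stays at
    distance at least [r / 2] from the complement, so it misses all thinner layers. *)
Lemma thin_layer_interior x : Omega x ->
  exists2 r, 0 < r & thin_layer Omega (ball x r).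
Proof.
move=> Ox; have /nbhs_ballP[r /= r0 rO] := open_nbhs_nbhs (conj oOmega Ox).
exists (r / 2); first exact: divr_gt0.
apply: (@thin_layer_ball _ _ 0) => //; first exact: divr_gt0.
move=> e /andP[e0 er]; rewrite (_ : _ `&` _ = set0) ?measure0 ?mul0r//.
apply/seteqP; split => // y [xy [_ /= /(setdist_lt Omega_proper)[z nOz yz]]].
apply: nOz; apply: rO; apply: (@ball_split _ _ y) => //.
by rewrite mx_norm_ball; exact: lt_trans er.
Qed.

(** [lipschitz] asks for the bound with all large constants; one positive constant is extracted. *)
Lemma lipschitz_constant m (g : 'rV[R]_m -> R) : lipschitz g ->
  exists2 L, 0 < L & forall u v, `|g u - g v| <= L * `|u - v|.
Proof.
move=> [M [_ gM]]; exists (Num.max 1 (M + 1)); first by rewrite lt_max ltr01.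
move=> u v; apply: (gM _ _ (u, v)) => //.
by rewrite lt_max ltrDl ltr01 orbT.
Qed.

(* At scale [e] the layer along a Lipschitz graph is covered by [O(e^-n)] balls of radius [O(e)] centred at
   rotated graph points over a grid of step [O(e)]; this way no rotation invariance of the measure is needed. *)
Lemma thin_layer_boundary (Q : 'M[R]_n.+1) (g : 'rV[R]_n -> R) x :
  Q *m Q^T = 1%:M -> lipschitz g ->
  (\forall y \near x,
     Omega y <-> g (row_uncons (y *m Q)).2 < (row_uncons (y *m Q)).1) ->
  exists2 r, 0 < r & thin_layer Omega (ball x r).
Proof.
move=> QQ /lipschitz_constant[L L0 gL] /nbhs_ballP[r2 r20 hO].
rewrite /= in r20; have [c c1 Qc] := mulmx_norm_le Q; have [c' c'1 Qc'] := mulmx_norm_le Q^T.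
have c0 := lt_le_trans ltr01 c1; have c'0 := lt_le_trans ltr01 c'1.
pose r := r2 / 2; have r0 : 0 < r by exact: divr_gt0.
(* At scale [e], [3 * (L + 1) * c] bounds the distance, in rotated coordinates, from a layer point
   to its grid point on the graph: [2 * L * c] comes from the grid step and [(L + 1) * c] from the
   height above the graph. [c'] accounts for rotating back, and the final 1 makes the inequality
   strict. *)
pose K := c' * (3 * (L + 1) * c) + 1.
have K0 : 0 < K.
  by rewrite ltr_wpDl// !mulr_ge0// ?addr_ge0// ltW.
exists r => //; apply: (@thin_layer_ball _ _ ((3 * r) ^+ n * (2 * K) ^+ n.+1)) => //.
  by rewrite mulr_ge0// exprn_ge0// mulr_ge0// ltW.
move=> e /andP[e0 er].
(* The successor gives [r / e < m], so the grid step is at most [2 * c * e], while m + 1 <= 3 r / e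
   because [e < r]. *)
pose m := (Num.truncn (r / e)).+1.
have re0 : 0 <= r / e by rewrite divr_ge0// ltW.
have mR : 0 < m%:R :> R by rewrite ltr0n.
have /andP[m_ge m_lt] := truncn_itv re0.
rewrite -/m in m_lt.
have [p pP] := @grid_approximation R n (row_uncons (x *m Q)).2 (c * r) m
  (mulr_gt0 c0 r0) isT.
pose z i := row_cons (g (p i), p i) *m Q^T.
have cover : ball x r `&` boundary_layer Omega e `<=`
    \big[setU/set0]_(i : 'rV['I_m.+1]_n) ball (z i) (K * e).
  move=> y [xy [Oy /= /(setdist_lt Omega_proper)[y' nOy' yy']]].
  rewrite mx_norm_ball /ball_/= in xy.
  (* The graph description holds on the ball of radius [r2], twice [r], which also contains the
     complement point [y'], closer than [e < r] to [y]. Hence [y] lies above the graph and [y'] does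
     not. *)
  have y2 : ball x r2 y by rewrite mx_norm_ball /ball_/= (lt_trans xy)// ltr_pdivrMr// ltr_pMr// ltr1n.
  have y'2 : ball x r2 y'.
    rewrite mx_norm_ball /ball_/= (le_lt_trans (ler_distD y _ _))//.
    by rewrite (splitr r2) ltrD// (lt_trans yy').
  have /hO[/(_ Oy) gy _] := y2.
  have /hO[_ gy'] := y'2.
  have {}gy' : (row_uncons (y' *m Q)).1 <= g (row_uncons (y' *m Q)).2.
    by rewrite leNgt; apply/negP => /gy'.
  have dQ (u v : V) : `|u *m Q - v *m Q| <= c * `|u - v|.
    by rewrite -mulmxBl; exact: Qc.
  have [d1 d2] := row_uncons_dist_le (y *m Q) (y' *m Q).
  have [_ d3] := row_uncons_dist_le (y *m Q) (x *m Q).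
  have yy'c : c * `|y - y'| <= c * e by rewrite ler_wpM2l ?ltW.
  have := dQ y y'; have := dQ y x.
  move: (row_uncons (y' *m Q)).1 (row_uncons (y' *m Q)).2 gy' d1 d2 => t' v' gy' d1 d2 dyx dyy'.
  have yx : `|y - x| <= r by rewrite distrC ltW.
  have [|i yi] := pP (row_uncons (y *m Q)).2.
    by rewrite (le_trans d3)// (le_trans dyx)// ler_wpM2l// ltW.
  have step : 2 * (c * r) / m%:R <= 2 * c * e.
    by rewrite ler_pdivrMr// -!mulrA !ler_wpM2l ?(ltW c0)// mulrC -ler_pdivrMr// ltW.
  rewrite (bigD1 i)//=; left.
  rewrite mx_norm_ball /ball_/=.
  have -> : z i - y = (row_cons (g (p i), p i) - y *m Q) *m Q^T.
    by rewrite mulmxBl -mulmxA QQ mulmx1.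
  apply: (le_lt_trans (Qc' _)); rewrite /K mulrDl mul1r.
  apply: (@le_lt_trans _ _ (c' * (3 * (L + 1) * c) * e)); last by rewrite ltrDl.
  rewrite -[leRHS]mulrA ler_wpM2l ?(ltW c'0)//.
  rewrite -[y *m Q]row_unconsK.
  move: (row_uncons (y *m Q)) gy d1 d2 d3 yi => [t v] /= gy d1 d2 d3 yi.
  have b1 : `|v - p i| <= 2 * c * e by exact: (le_trans yi step).
  have b2 : `|g (p i) - g v| <= L * (2 * c * e).
    by rewrite (le_trans (gL _ _))// ler_wpM2l ?(ltW L0)// distrC.
  have b3 : `|g v' - g v| <= L * (c * e).
    rewrite (le_trans (gL _ _))// ler_wpM2l ?(ltW L0)// distrC.
    by rewrite (le_trans d2)// (le_trans dyy').
  have b4 : `|t - t'| <= c * e by rewrite (le_trans d1)// (le_trans dyy').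
  have ce0 : 0 < c * e by rewrite mulr_gt0.
  have Lce0 : 0 < L * (c * e) by rewrite mulr_gt0.
  apply: norm_le_entry; first by rewrite !mulr_ge0// ?addr_ge0// ltW.
  apply/forall_ordS; split.
    (* Height of [y] over the graph: g v < t <= t' + c e <= g v' + c e <= g v + (L + 1) c e. *)
    rewrite [X in `|X|]mxE [X in _ + X]mxE !row_cons0/=.
    move: b2 b3 b4; rewrite !ler_distl => /andP[? ?] /andP[? ?] /andP[? ?].
    apply/andP; split; nra.
  move=> j; rewrite [X in `|X|]mxE [X in _ + X]mxE !row_consS/=.
  have := entry_le_norm (v - p i) j; rewrite !mxE distrC => /le_trans; apply.
  by rewrite (le_trans b1)//; nra.
have mlay : lebesgue_measurable (ball x r `&` boundary_layer Omega e).
  apply: measurableI; last exact: measurable_boundary_layer.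
  by apply: open_lebesgue_measurable; exact: ball_open.
have mballs i : lebesgue_measurable (ball (z i) (K * e)).
  by apply: open_lebesgue_measurable; exact: ball_open.
apply: (le_trans (lebesgue_le mlay _ cover)).
  by elim/big_ind : _ => //; [exact: measurable0|move=> A B; exact: measurableU].
apply: (le_trans (measure_bigsetU_le lam _ mballs)).
apply: (@le_trans _ _ (\sum_(i : 'rV['I_m.+1]_n) ((2 * (K * e)) ^+ n.+1)%:E)%E).
  apply: lee_sum => i _; rewrite mx_norm_ball.
  by apply: lebesgue_rV_ball_le; rewrite mulr_ge0// ltW.
(* There are (m + 1)^n balls of volume at most (2 K e)^(n+1); all powers of [e] but one cancel. *)
rewrite sumEFin lee_fin sumr_const card_mx card_ord mul1n.
have m3 : m.+1%:R <= 3 * r / e.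
  have : 1 <= r / e by rewrite ler_pdivlMr// mul1r ltW.
  rewrite -mulrA -!natr1; move: m_ge; lra.
rewrite -[leLHS]mulr_natl natrX.
apply: (@le_trans _ _ ((3 * r / e) ^+ n * (2 * (K * e)) ^+ n.+1)).
  rewrite ler_wpM2r//; first by rewrite exprn_ge0// !mulr_ge0// ltW.
  apply: lerXn2r => //; rewrite nnegrE//.
  by rewrite divr_ge0 ?(ltW e0)// mulr_ge0// ltW.
rewrite [2 * (K * e)]mulrA [(_ * e) ^+ _]exprMn [(_ / e) ^+ _]exprMn.
have ee : e^-1 ^+ n * e ^+ n = 1 by rewrite -exprMn mulVf ?expr1n// gt_eqF.
rewrite [e ^+ n.+1]exprS; move: (e^-1 ^+ n) (e ^+ n) ee => a b ab.
have -> : (3 * r) ^+ n * a * ((2 * K) ^+ n.+1 * (e * b)) =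
          (3 * r) ^+ n * (2 * K) ^+ n.+1 * e * (a * b) by ring.
by rewrite ab mulr1.
Qed.

Hypothesis bOmega : bounded_set Omega.
Hypothesis lipOmega : lipschitz_boundary Omega.

Lemma compact_closure_bounded : compact (closure Omega).
Proof.
apply: bounded_closed_compact; last exact: closed_closure.
case: bOmega => M [Mr OM]; exists (M + 1); split; first exact: num_real.
move=> c Mc y /(_ (ball y 1) (nbhsx_ballx _ _ ltr01))[z [Oz]].
rewrite mx_norm_ball /ball_/= => yz.
have {}Oz : `|z| <= c - 1 by apply: (OM (c - 1)) => //; rewrite ltrBrDr.
have := ler_normB (y - z) (- z); rewrite normrN opprK subrK; lra.
Qed.

(** Compactness: finitely many balls with a thin layer cover the closure of [Omega], hence every
    layer. *)
Lemma boundary_layer_le : exists2 M : R, 0 <= M &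
  forall e, 0 < e -> (lam (boundary_layer Omega e) <= (M * e)%:E)%E.
Proof.
have hr x : exists r, closure Omega x -> 0 < r /\ thin_layer Omega (ball x r).
  (* Off the closure the radius is the dummy 0, which makes the choice function total. *)
  have [cx|ncx] := pselect (closure Omega x); last by exists 0.
  have [Ox|nOx] := pselect (Omega x).
    by have [r ? ?] := thin_layer_interior Ox; exists r.
  have [|Q [g [QQ gL h]]] := lipOmega (x := x).
    by split => // /interior_subset.
  by have [r ? ?] := thin_layer_boundary QQ gL h; exists r.
have [r hr'] := choice hr.
have := compact_closure_bounded; rewrite compact_cover.
move=> /(_ _ (closure Omega) (fun x => ball x (r x))) [||D DO cover].
- by move=> x _; exact: ball_open.
- by move=> x cx; exists x => //; apply: ballxx; exact: (hr' _ cx).1.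
have [mS [M M0 hM]] : thin_layer Omega (\bigcup_(x in [set` D]) ball x (r x)).
  rewrite bigcup_fset big_seq_cond.
  elim/big_ind : _ => [||x /andP[xD _]]; first exact: thin_layer0.
    exact: thin_layerU.
  by have := DO _ xD; rewrite inE => /hr'[].
exists M => // e e0; apply: le_trans (hM _ e0).
apply: lebesgue_le; first exact: measurable_boundary_layer.
  by apply: measurableI => //; exact: measurable_boundary_layer.
by move=> x xO; split => //; apply: cover; apply: subset_closure; case: xO.
Qed.

End boundary_layer.

(** * Interaction across level sets of the distance *)

Section layer_interaction.
Context {R : realType} {n : nat}.
Local Notation V := 'rV[R]_n.+1.
Local Notation lam := (lebesgue_rV n.+1).
Local Notation rVn := (caratheodory_type ((borel_lebesgue R n.+1)^*)%mu).
Variables (s : R) (Omega : set V) (M : R).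
Hypothesis s01 : 0 < s < 1.
Hypothesis oOmega : open Omega.
Hypothesis Omega_proper : ~` Omega !=set0.
Hypothesis M0 : 0 <= M.
Hypothesis layerM : forall e, 0 < e ->
  (lam (boundary_layer Omega e) <= (M * e)%:E)%E.
Local Notation dist := (setdist (~` Omega)).
Local Notation inner r := [set x | r <= dist x].

Lemma dist_gt0 x : Omega x -> 0 < dist x.
Proof.
move=> Ox; apply: setdist_gt0 => //; by rewrite closedC.
Qed.

Lemma inner_sub r : 0 < r -> inner r `<=` Omega.
Proof.
move=> r0 x /= rx; apply: contrapT => nOx.
by move: rx; rewrite (setdist_eq0 Omega_proper)// leNgt r0.
Qed.

Lemma measurable_inner r : lebesgue_measurable (inner r).
Proof.
rewrite (_ : mkset _ = ~` [set x | dist x < r]).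
  by apply: measurableC; apply: open_lebesgue_measurable; exact: open_setdist_lt.
by apply/seteqP; split => x /=; rewrite leNgt => /negP.
Qed.

Lemma measurable_dist (D : set V) : lebesgue_measurable D ->
  measurable_fun (D : set rVn) dist.
Proof.
move=> mD; apply: measurable_funTS.
apply: (measurability (RGenInftyO.G (R := R)) (RGenInftyO.measurableE R)).
move=> _ [_ [x ->] <-]; rewrite setTI.
apply: open_lebesgue_measurable.
rewrite (_ : _ @^-1` _ = [set y | dist y < x]); first exact: open_setdist_lt.
by apply/seteqP; split => y /=; rewrite in_itv.
Qed.

Lemma boundary_layerS a b : a <= b ->
  boundary_layer Omega a `<=` boundary_layer Omega b.
Proof. by move=> ab x [Ox /= xa]; split => //; exact: lt_le_trans xa ab. Qed.

Let mlayer r : lebesgue_measurable (boundary_layer Omega r).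
Proof. exact: measurable_boundary_layer. Qed.

Lemma layer_fin r : lam (boundary_layer Omega r) \is a fin_num.
Proof.
(* The width is raised to [Num.max r 1] since [layerM] speaks of positive widths. *)
rewrite ge0_fin_numE//; apply: (@le_lt_trans _ _ (M * Num.max r 1)%:E); last exact: ltry.
apply: le_trans (layerM _); last by rewrite lt_max ltr01 orbT.
by apply: lebesgue_le => //; apply: boundary_layerS; rewrite le_max lexx.
Qed.

(** [rising_sun] is applied to the volume of the layer as a function of its width, with slope
    [M + 1]: the extra 1 makes the required inequality strict. The set at hand has as volume the
    increment from [t - e] to [t]. *)
Lemma layer_rising_sun a : 0 < a -> exists2 t, 0 < t <= a &
  forall e, 0 < e <= t ->
    (lam (boundary_layer Omega t `&` [set x | (t - dist x <= e)%R])
       <= ((M + 1) * e)%:E)%E.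
Proof.
move=> a0; pose V r := fine (lam (boundary_layer Omega r)).
have [||t [ta Vt]] := @rising_sun _ V a (M + 1) a0 (addr_ge0 M0 ler01).
- move=> x y xy; apply: fine_le; try exact: layer_fin.
  by apply: lebesgue_le => //; exact: boundary_layerS.
- have V0 : 0 <= V 0 by apply: fine_ge0.
  have : V a <= M * a by rewrite -lee_fin fineK ?layer_fin ?layerM.
  lra.
exists t => // e /andP[e0 et].
have -> : boundary_layer Omega t `&` [set x | t - dist x <= e] =
    boundary_layer Omega t `\` boundary_layer Omega (t - e).
  apply/seteqP; split => x [[Ox /= xt]].
    by move=> xe; split=> // -[_ /=]; lra.
  move=> nx; split => //=; rewrite lerBlDl -lerBlDr leNgt.
  by apply/negP => ?; exact: nx.
rewrite measureD; [|exact: mlayer|exact: mlayer|]; last first.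
  by rewrite -ge0_fin_numE// layer_fin.
rewrite setIidr; last by apply: boundary_layerS; lra.
apply: (@le_trans _ _ ((V t)%:E - (V (t - e))%:E)%E).
  by rewrite /V !fineK ?layer_fin.
rewrite -EFinB lee_fin; have := Vt (t - e); rewrite subKr; apply.
by apply/andP; split; lra.
Qed.

Local Notation energy := (kernel_interaction lam (riesz_kernel s)).

(** The distance is 1-Lipschitz, so a point [x] of the layer is at least [t - dist x] away from
    [inner t], and the kernel tail contributes a multiple of (t - dist x)^-s. The volume hypothesis
    makes this integrable, through [integral_powR_neg_le] with [b = t]. *)
Lemma inner_layer_energy_le t : 0 < t ->
  (forall e, 0 < e <= t ->
    (lam (boundary_layer Omega t `&` [set x | (t - dist x <= e)%R])
       <= ((M + 1) * e)%:E)%E) ->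
  (energy (boundary_layer Omega t) (inner t) <=
    (4 ^+ n.+1 / (1 - 2 `^ (- s)) *
      (2 `^ s / (1 - 2 `^ s / 2) * ((M + 1) * t `^ (1 - s))))%:E)%E.
Proof.
have /andP[s0 s1] := s01; move=> t0 ht.
have C0 : 0 <= 4 ^+ n.+1 / (1 - 2 `^ (- s)) :> R.
  rewrite divr_ge0 ?exprn_ge0// subr_ge0 powRN invf_le1 ?powR_gt0//.
  by rewrite -[leLHS](powRr0 2) ler_powR ?ler1n// ltW.
have mu_ : measurable_fun (boundary_layer Omega t : set rVn) (fun x => t - dist x).
  by apply: measurable_funB; [exact: measurable_cst|exact: measurable_dist].
have mp : measurable_fun (boundary_layer Omega t : set rVn) (fun x => (t - dist x) `^ (- s)).
  exact: measurableT_comp (measurable_powR _) mu_.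
apply: (@le_trans _ _ (\int[lam]_(x in boundary_layer Omega t)
   ((4 ^+ n.+1 / (1 - 2 `^ (- s)))%:E * ((t - dist x) `^ (- s))%:E))%E).
  apply: inter_le.
  - exact: riesz_kernel_ge0.
  - exact: measurable_riesz_kernel.
  - exact: mlayer.
  - exact: measurable_inner.
  - by apply: emeasurable_funM; [exact: measurable_cst|exact/measurable_EFinP].
  move=> x [Ox /= xt]; rewrite -EFinM; apply: integral_riesz_kernel_le => //.
  - by rewrite subr_gt0.
  - exact: measurable_inner.
  - by move=> y /= ty; have := setdist_lipschitz Omega_proper y x; rewrite distrC; lra.
rewrite ge0_integralZl; last 4 first.
- exact: mlayer.
- exact/measurable_EFinP.
- by move=> x _; rewrite lee_fin powR_ge0.
- exact: C0.
rewrite [leRHS]EFinM lee_wpmul2l ?lee_fin//.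
apply: integral_powR_neg_le => //; [by rewrite addr_ge0|exact: mlayer|].
move=> x [Ox /= xt]; rewrite subr_gt0 xt/= lerBlDl lerDr.
exact: setdist_ge0.
Qed.

Lemma small_inner_layer_energy a e : 0 < a -> 0 < e ->
  exists2 t, 0 < t <= a &
    (energy (boundary_layer Omega t) (inner t) <= e%:E)%E.
Proof.
move=> a0 e0; have /andP[s0 s1] := s01.
pose C := 4 ^+ n.+1 / (1 - 2 `^ (- s)) * (2 `^ s / (1 - 2 `^ s / 2) * (M + 1)).
(* The second entry solves (|C| + 1) b^(1-s) = e; |C| + 1 is positive whatever the sign of [C]. *)
pose b := Num.min a ((e / (`|C| + 1)) `^ (1 - s)^-1).
have C1 : 0 < `|C| + 1 by rewrite ltr_wpDl.
have b0 : 0 < b by rewrite lt_min a0 powR_gt0// divr_gt0.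
have [t /andP[t0 tb] ht] := layer_rising_sun b0.
exists t; first by rewrite t0 (le_trans tb)// ge_min lexx.
apply: (le_trans (inner_layer_energy_le t0 ht)).
rewrite lee_fin (_ : _ * _ = C * t `^ (1 - s)); last by rewrite /C; ring.
have ts : t `^ (1 - s) <= e / (`|C| + 1).
  apply: (@le_trans _ _ (b `^ (1 - s))).
    by rewrite ge0_ler_powR ?nnegrE ?subr_ge0 ?(ltW s1) ?(ltW t0) ?(ltW b0).
  apply: (@le_trans _ _ (((e / (`|C| + 1)) `^ (1 - s)^-1) `^ (1 - s))).
    rewrite ge0_ler_powR ?nnegrE ?subr_ge0 ?(ltW s1) ?(ltW b0) ?powR_ge0//.
    by rewrite ge_min lexx orbT.
  by rewrite -powRrM mulVf ?powRr1 ?divr_ge0 ?(ltW e0) ?(ltW C1)// subr_eq0 gt_eqF.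
apply: (@le_trans _ _ ((`|C| + 1) * t `^ (1 - s))).
  by rewrite ler_wpM2r ?powR_ge0// (le_trans (ler_norm C))// lerDl.
by rewrite mulrC -ler_pdivlMr.
Qed.

Hypothesis bOmega : bounded_set Omega.

(** A point [x] of [Omega] is at distance at least [dist x] from the complement, so the interaction
    is at most a multiple of the integral of dist^-s, finite by the linear bound on the layers. *)
Lemma energy_complement_fin : (energy Omega (~` Omega) < +oo)%E.
Proof.
have /andP[s0 s1] := s01.
have mO : lebesgue_measurable Omega by exact: open_lebesgue_measurable.
have [b b0 hb] : exists2 b, 0 < b & forall x, Omega x -> dist x <= b.
  have [y nOy] := Omega_proper; case: bOmega => B [Br hB].
  exists (`|B| + 1 + `|y|) => [|x Ox]; first by rewrite ltr_wpDr// ltr_wpDl.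
  apply: (le_trans (setdist_le Omega_proper x nOy)); apply: (le_trans (ler_normB _ _)).
  rewrite lerD2r; apply: (hB (`|B| + 1)) => //.
  by rewrite (le_lt_trans (ler_norm B))// ltrDl.
have mp : measurable_fun (Omega : set rVn) (fun x => (dist x) `^ (- s)).
  by apply: measurableT_comp (measurable_powR _) _; exact: measurable_dist.
have C0 : 0 <= 4 ^+ n.+1 / (1 - 2 `^ (- s)) :> R.
  rewrite divr_ge0 ?exprn_ge0// subr_ge0 powRN invf_le1 ?powR_gt0//.
  by rewrite -[leLHS](powRr0 2) ler_powR ?ler1n// ltW.
apply: (@le_lt_trans _ _ (\int[lam]_(x in Omega)
   ((4 ^+ n.+1 / (1 - 2 `^ (- s)))%:E * ((dist x) `^ (- s))%:E))%E).
  apply: inter_le.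
  - exact: riesz_kernel_ge0.
  - exact: measurable_riesz_kernel.
  - exact: mO.
  - exact: measurableC.
  - by apply: emeasurable_funM; [exact: measurable_cst|exact/measurable_EFinP].
  move=> x Ox; rewrite -EFinM; apply: integral_riesz_kernel_le => //.
  - exact: dist_gt0.
  - exact: measurableC.
  - by move=> y nOy; exact: setdist_le.
rewrite ge0_integralZl; last 4 first.
- exact: mO.
- exact/measurable_EFinP.
- by move=> x _; rewrite lee_fin powR_ge0.
- exact: C0.
rewrite lte_mul_pinfty ?lee_fin//.
apply: (@le_lt_trans _ _ (2 `^ s / (1 - 2 `^ s / 2) * ((2 * M) * b `^ (1 - s)))%:E); last exact: ltry.
apply: integral_powR_neg_le => //.
- by rewrite mulr_ge0.
- exact: measurable_dist.
- by move=> x Ox; rewrite dist_gt0// hb.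
(* Layers are cut out by a strict inequality, so [dist x <= e] is placed in the layer of width
   [2 * e]; this doubles [M]. *)
move=> e /andP[e0 eb]; rewrite [2 * M]mulrC -mulrA.
apply: le_trans (layerM _); last by rewrite mulr_gt0.
apply: lebesgue_le => //; last first.
  by move=> x [Ox /= xe]; split => //=; rewrite (le_lt_trans xe)// ltr_pMl// ltr1n.
apply: measurableI => //.
rewrite (_ : mkset _ = ~` [set x | e < dist x]).
  by apply: measurableC; apply: open_lebesgue_measurable; exact: open_setdist_gt.
by apply/seteqP; split => x /=; rewrite leNgt => /negP.
Qed.

End layer_interaction.

(** * Minimality *)

Section minimality.
Context {R : realType} {n : nat}.
Local Notation V := 'rV[R]_n.+1.
Local Notation lam := (lebesgue_rV n.+1).
Variable s : R.
Implicit Types E F Omega : set V.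

Lemma s_perimeterE E Omega :
  s_perimeter s E Omega = kernel_perimeter lam (riesz_kernel s) E Omega.
Proof. by []. Qed.

Local Notation rVn := (caratheodory_type ((borel_lebesgue R n.+1)^*)%mu).

(* [riesz_kernel] is restated on the type carrying the Lebesgue-measurable sets: on ['rV_n.+1] itself the Borel
   structure would be inferred. *)
Let K_ge0 (z : rVn * rVn) : (0 <= riesz_kernel s z)%E.
Proof. exact: riesz_kernel_ge0. Qed.

Let K_sym (x y : rVn) : riesz_kernel s (x, y) = riesz_kernel s (y, x).
Proof. exact: riesz_kernel_sym. Qed.

Let mK : measurable_fun [set: rVn * rVn] (riesz_kernel s : rVn * rVn -> \bar R).
Proof. exact: measurable_riesz_kernel. Qed.

Lemma s_perimeter_null E F Omega : lebesgue_measurable E ->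
  lebesgue_measurable F -> lebesgue_measurable Omega -> null_eq E F ->
  s_perimeter s E Omega = s_perimeter s F Omega.
Proof.
move=> mE mF mO EF; rewrite !s_perimeterE; apply: (per_null K_ge0 mK mE mF mO).
by apply/negligibleP => //; rewrite /setY; apply: measurableU; exact: measurableD.
Qed.

Lemma null_eq_refl E F : E = F -> null_eq E F.
Proof. by move=> ->; rewrite /null_eq setYK; exact: negligible_set0. Qed.

Lemma compactly_containedS A B Omega : compactly_contained B Omega ->
  A `<=` B -> compactly_contained A Omega.
Proof.
move=> [cB BO] AB; have cAB := closure_subset AB.
split; last exact: subset_trans BO.
by apply: (subclosed_compact _ cB cAB); exact: closed_closure.
Qed.

(** Up to a null set [E] and [F] differ only in [D], hence only inside [Omega]. *)
Lemma s_minimal_s_minimal_compact Omega E :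
  s_minimal s Omega E -> s_minimal_compact s Omega E.
Proof.
move=> [finE minE]; split; first exact: finE.
move=> F mF [D EFD [_ DO]]; apply: (minE F mF).
apply: negligibleS EFD => x; rewrite /setY /= => xFE.
have [Dx|nDx] := pselect (D x); last tauto.
have := DO _ (subset_closure Dx); tauto.
Qed.

Lemma s_minimal_compact_locally Omega E : open Omega ->
  lebesgue_measurable E ->
  s_minimal_compact s Omega E -> locally_s_minimal s Omega E.
Proof.
move=> oO mE [finE minE] W oW cW.
have mO := open_lebesgue_measurable oO; have mW := open_lebesgue_measurable oW.
have WO : W `<=` Omega by apply: subset_trans cW.2; exact: subset_closure.
split; first by apply: le_lt_trans finE; exact: (perS lam K_ge0 mK mE mW mO WO).
(* [F] agrees with [E] off [W] only up to a null set; [G] does so exactly, as [per_le_sub] requires,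
   and differs from [E] only inside [W]. *)
move=> F mF FE; pose G := (F `&` W) `|` (E `\` W).
have mG : lebesgue_measurable G.
  by apply: measurableU; [exact: measurableI|exact: measurableD].
have FG : null_eq F G by apply: negligibleS FE => x; rewrite /setY /G /=; tauto.
rewrite (s_perimeter_null mF mG mW FG).
have GE : G `\` W = E `\` W by apply/seteqP; split => x; rewrite /G /=; tauto.
apply: (@per_le_sub _ _ _ lam _ K_ge0 mK E G W Omega mE mG mW mO WO GE finE).
apply: (minE G mG); exists (E `+` G); first exact: null_eq_refl.
apply: compactly_containedS cW _ => x; rewrite /setY /G /=.
have [?|?] := pselect (W x); tauto.
Qed.

(** A constant row exceeding the bound lies outside; it has an entry because the dimension is
    [n.+1]. *)
Lemma bounded_setC_neq0 Omega : bounded_set Omega -> ~` Omega !=set0.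
Proof.
move=> [B [_ hB]]; exists (const_mx (`|B| + 2)) => OB.
have /(_ _ OB) : forall x, Omega x -> `|x| <= `|B| + 1.
  by apply: hB; rewrite (le_lt_trans (ler_norm B))// ltrDl.
have := entry_le_norm (const_mx (`|B| + 2) : V) 0.
rewrite mxE ger0_norm ?addr_ge0//; lra.
Qed.

(** This serves twice: the competitor equal to [E] minus [Omega] shows that the perimeter is finite,
    and a general one yields minimality. *)
Lemma locally_s_minimal_le Omega E F : 0 < s < 1 ->
  open Omega -> bounded_set Omega -> lipschitz_boundary Omega ->
  lebesgue_measurable E -> lebesgue_measurable F ->
  locally_s_minimal s Omega E -> E `\` Omega = F `\` Omega ->
  (s_perimeter s E Omega <= s_perimeter s F Omega)%E.
Proof.
move=> s01 oO bO lO mE mF locE EF.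
have mO := open_lebesgue_measurable oO.
have nO := bounded_setC_neq0 bO.
have [M M0 layerM] := boundary_layer_le oO nO bO lO.
pose A r := [set x | r <= setdist (~` Omega) x].
have mA r : lebesgue_measurable (A r) by exact: measurable_inner.
have AO r : 0 < r -> A r `<=` Omega by exact: inner_sub.
(* [A t] is closed whereas local minimality concerns open sets: [W] lies between [A t] and
   [A (t / 2)] and is compactly contained in [Omega]. *)
have minA t : 0 < t -> forall G, lebesgue_measurable G -> G `\` A t = E `\` A t ->
    (s_perimeter s E (A t) <= s_perimeter s G (A t))%E.
  move=> t0 G mG GE; pose W := [set x | t / 2 < setdist (~` Omega) x].
  have t20 : 0 < t / 2 by exact: divr_gt0.
  have oW : open W by exact: open_setdist_gt.
  have mW := open_lebesgue_measurable oW.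
  have AW : A t `<=` W by move=> x /=; rewrite /A /W /=; lra.
  have cWA : closure W `<=` A (t / 2).
    rewrite [X in _ `<=` X](closure_id _).1; last exact: closed_setdist_ge.
    by apply: closure_subset => x /ltW.
  have cW : compactly_contained W Omega.
    split; last exact: subset_trans (AO _ t20).
    apply: subclosed_compact (compact_closure_bounded bO) _.
      exact: closed_closure.
    apply: closure_subset; apply: subset_trans (AO _ t20).
    by move=> x /ltW.
  have [finW minW] := locE _ oW cW.
  apply: (@per_le_sub _ _ _ lam _ K_ge0 mK E G (A t) W mE mG (mA t) mW AW GE finW).
  apply: (minW G mG); apply: null_eq_refl.
  have GEx x : ~ A t x -> G x <-> E x.
    move=> Ax; split=> ?.
      by have [] : (E `\` A t) x by rewrite -GE.
    by have [] : (G `\` A t) x by rewrite GE.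
  by apply/seteqP; split => x /= [Hx nWx]; split => //; apply/GEx => // /AW.
have OA : Omega = \bigcup_j A j.+1%:R^-1.
  apply/seteqP; split; last by move=> x [j _]; apply: AO.
  move=> x Ox; have d0 := dist_gt0 oO nO Ox.
  exists (Num.bound (setdist (~` Omega) x)^-1) => //=.
  rewrite /A /= -[leRHS]invrK lef_pV2 ?posrE ?invr_gt0//.
  apply/ltW; apply: lt_trans (archi_boundP _) _; first by rewrite invr_ge0 ltW.
  by rewrite ltr_nat.
have ndA : {homo (fun j => A j.+1%:R^-1) : i j / (i <= j)%N >-> i `<=` j}.
  by move=> i j ij x; apply: le_trans; rewrite lef_pV2 ?posrE// ler_nat ltnS.
rewrite [X in s_perimeter _ _ X]OA.
apply: (per_bigcup_le K_ge0 mK mE (fun j => mA _) ndA) => j.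
apply/lee_addgt0Pr => e e0.
(* Taking [t] at most 1/(j+1) makes [A t] contain the set of index [j]; the interaction occurs twice
   in [per_truncation_le], hence [e / 2]. *)
have [|t /andP[t0 tj] small] := small_inner_layer_energy s01 oO nO M0 layerM
  (a := j.+1%:R^-1) (e := e / 2) _ (divr_gt0 e0 (ltr0n _ 2)).
  by [].
apply: (@le_trans _ _ (s_perimeter s E (A t))).
  by apply: (perS lam K_ge0 mK mE (mA _) (mA _)) => x; exact: (le_trans tj).
have mG : lebesgue_measurable ((F `&` A t) `|` (E `\` A t)).
  exact: measurableU (measurableI _ _ mF (mA t)) (measurableD mE (mA t)).
apply: (le_trans (minA t t0 _ mG _)).
  by apply/seteqP; split => x /=; tauto.
apply: (le_trans (per_truncation_le lam K_ge0 mK K_sym mE mF (mA t) mO (AO _ t0) EF)).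
apply: leeD2l; rewrite (splitr e) EFinD.
have layerE : Omega `\` A t = boundary_layer Omega t.
  apply/seteqP; split => x [Ox /=]; rewrite /A /=.
    by move=> /negP; rewrite -ltNge.
  by move=> xt; split => //=; apply/negP; rewrite -ltNge.
by rewrite layerE; apply: leeD.
Qed.

Lemma locally_s_minimal_s_minimal Omega E : 0 < s < 1 ->
  open Omega -> bounded_set Omega -> lipschitz_boundary Omega ->
  lebesgue_measurable E -> locally_s_minimal s Omega E -> s_minimal s Omega E.
Proof.
move=> s01 oO bO lO mE locE.
have mO := open_lebesgue_measurable oO.
have nO := bounded_setC_neq0 bO.
have [M M0 layerM] := boundary_layer_le oO nO bO lO.
split.
  (* This competitor is empty inside [Omega]: its crossing pairs touching [Omega] all go from the
     complement into [Omega]. *)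
  apply: (@le_lt_trans _ _ (s_perimeter s (E `\` Omega) Omega)).
    apply: (locally_s_minimal_le s01 oO bO lO mE _ locE); first exact: measurableD.
    by rewrite setDDl setUid.
  apply: le_lt_trans (energy_complement_fin s01 oO nO M0 layerM bO).
  have mD : lebesgue_measurable (E `\` Omega) by exact: measurableD.
  have mC : lebesgue_measurable (~` Omega) by exact: measurableC.
  rewrite s_perimeterE (perE lam K_ge0 mK mD mO).
  rewrite (inter_sym lam K_ge0 mK K_sym mO mC) (interE lam K_ge0 mK mC mO).
  apply: (pair_energyS lam K_ge0 mK).
  - apply: measurableI; last exact: measurable_touching.
    exact: measurable_cross.
  - exact: measurableX.
  by move=> [x y] /= [[[Ex nOx] _] []] [].
move=> F mF FE; pose G := (F `&` Omega) `|` (E `\` Omega).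
have mG : lebesgue_measurable G.
  by apply: measurableU; [exact: measurableI|exact: measurableD].
have FG : null_eq F G by apply: negligibleS FE => x; rewrite /setY /G /=; tauto.
rewrite (s_perimeter_null mF mG mO FG).
apply: (locally_s_minimal_le s01 oO bO lO mE mG locE).
by apply/seteqP; split => x; rewrite /G /=; tauto.
Qed.

End minimality.

Theorem theorem1p6 (R : realType) (n : nat) (s : R)
    (Omega E : set 'rV[R]_n.+1) :
  0 < s < 1 ->
  open Omega -> bounded_set Omega -> lipschitz_boundary Omega ->
  lebesgue_measurable E ->
  [<-> s_minimal s Omega E;
       s_minimal_compact s Omega E;
       locally_s_minimal s Omega E].
Proof.
move=> s01 oO bO lO mE; tfae.
- exact: s_minimal_s_minimal_compact.
- exact: s_minimal_compact_locally.
- exact: locally_s_minimal_s_minimal.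
Qed.
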